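(* Let $L\geq 1$ be an integer and $\omega=(\omega_0,\ldots,\omega_{L-1})\in\{0,1\}^L$. Assume that $0<\delta_1\leq\delta_2<2/3$. There exist $\eta>0$ and a constant $C$ such that \[ \sum_{D<d\leq 2D}\ \max_{0\leq y\leq z,\ z-y\leq x}\ \max_{j\in\mathbb Z} \left| A_\omega(y,z;d,j) - \frac{z-y}{2^Ld} \right| \leq C x^{1-\eta} \] for all real $x$ and $D$ such that $x\geq 1$ and $x^{\delta_1}\leq D\leq x^{\delta_2}$. Here the sum is over integers $d$, and $y,z$ range over real numbers.
   Context: For a nonnegative integer $n$, $s(n)$ is the number of $1$s in the binary expansion of $n$. For real $0\le y\le z$, an integer $d\ge 1$, an integer $j$, and $\omega\in\{0,1\}^L$, $A_\omega(y,z;d,j)$ is the number of integers $m$ with $y\leq m<z$ for which there exists $n\in\mathbb Z$ such that $m=nd+j$ and $s((n+\ell)d+j)\equiv \omega_\ell\bmod 2$ for all $0\leq \ell<L$. (Since $m\ge 0$, all arguments of $s$ are nonnegative.) The maxima are to be read as suprema. *)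

(* Defs.v *)
From mathcomp Require Import all_boot all_order all_algebra finmap.
From mathcomp Require Import all_classical all_reals all_analysis.

Set Implicit Arguments.
Unset Strict Implicit.
Unset Printing Implicit Defensive.

Import Order.TTheory GRing.Theory Num.Theory.

Local Open Scope classical_set_scope.
Local Open Scope ring_scope.

(* The i-th binary digit of n is n %/ 2 ^ i mod 2; it is 0 for i >= n, since
   n < 2 ^ n. *)
Definition binary_ones (n : nat) : nat :=
  #|[set i : 'I_n | odd (n %/ 2 ^ i)]%SET|.

(* When m = n * d + j >= 0, as is the case for the integers counted in
   [word_positions] with 0 <= y, the integer (n + l) * d + j is nonnegative, so
   that [absz] is only a cast to nat. *)
Definition word_at (L : nat) (omega : L.-tuple bool) (d : nat) (j n : int) :
    Prop :=
  forall l : 'I_L,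
    binary_ones (absz ((n + l%:Z) * d%:Z + j)) = tnth omega l %[mod 2].

Definition word_positions (R : realType) (L : nat) (omega : L.-tuple bool)
    (y z : R) (d : nat) (j : int) : set int :=
  [set m : int | y <= m%:~R < z /\
    exists n : int, m = n * d%:Z + j /\ word_at omega d j n].

(* [fset_set] is empty on infinite sets, but [word_positions] is bounded, hence
   finite. *)
Definition word_count (R : realType) (L : nat) (omega : L.-tuple bool)
    (y z : R) (d : nat) (j : int) : nat :=
  #|` fset_set (word_positions omega y z d j) |%fset.

(* The suprema are taken in \bar R, so that no junk value can arise from a set
   which is not known to be bounded. *)
Definition max_discrepancy (R : realType) (L : nat) (omega : L.-tuple bool)
    (x : R) (d : nat) : \bar R :=
  ereal_sup [set ereal_sup
      [set (`| (word_count omega yz.1 yz.2 d j)%:R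
               - (yz.2 - yz.1) / (2 ^+ L * d%:R) |)%:E | j in [set: int]]
    | yz in [set yz : R * R | 0 <= yz.1 <= yz.2 /\ yz.2 - yz.1 <= x]].

(* Main.v *)
(* The word condition is expanded into the sign sums over [n < N] of
   prod_(l in A) t((n + l) d + j), where t = (-1)^s and A is a nonempty set of
   indices; an even modulus d may be replaced by its odd part, since this only
   shifts the digits. With d < D and N slightly larger than D^(1/2), each sum is
   estimated on average over odd d, uniformly in j.

   A first application of van der Corput's inequality, with short shifts, makes
   the binary digits above a little more than D cancel. In the second one, the
   shifts k are grouped according to the leading digits of k d modulo 2^lam, so
   that in each group k d changes by at most 2^mu modulo 2^lam, where 2^mu is
   about D^(1/2). Then only the digits below 2^rho survive, with 2^rho a little
   larger than 2^mu. As N is a multiple of 2^rho and d is odd, n d + j is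
   equidistributed modulo 2^rho, and j disappears. Averaging over d and the
   differences e = k' - k makes the pair (d, e d) modulo 2^rho essentially
   uniform, and repeated Cauchy-Schwarz bounds the resulting average by a Gowers
   norm of t modulo 2^rho. The latter is processed block by block of k binary
   digits, with carries as states: in every state, two choices of digits lead to
   the same carries with opposite signs, so each block gains a constant factor,
   and the whole norm is exponentially small in rho. *)

Require Import Defs.
From mathcomp Require Import all_boot all_order all_algebra finmap.
From mathcomp Require Import all_classical all_reals all_analysis.
From mathcomp Require Import ring lra zify.

Set Implicit Arguments.
Unset Strict Implicit.
Unset Printing Implicit Defensive.

Import Order.TTheory GRing.Theory Num.Theory.

Local Open Scope ring_scope.

(** * The sign of the binary digit sum *)

(** The exponent 2/3 comes from the length [N] of the progressions. An incomplete one costs [N] for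
    each of about [D] moduli, so [D * N] has to stay below [x] by a power, with [N] close to
    [D ^ (1/2)]. A shorter [N] is out of reach of the second van der Corput step: there are about
    [D / 2 ^ mu] groups, which must be outnumbered by the shifts, themselves fewer than [N], while
    [2 ^ mu] must be small against [2 ^ rho], a divisor of [N]. The maximum over [j] stands inside
    the sum over [d]. Hence every bound for a single modulus must be free of [j] before [d] is
    averaged, and [j] can only be removed by running over complete residue systems. All scales are
    powers of [2 ^ t]. The passage from [(d, e)] to uniform pairs and the Cauchy-Schwarz steps lose
    a bounded power of [2 ^ t], whereas the norm modulo [2 ^ rho], with [rho = (q + 8) * t], gains
    [2 ^ (- c * q * t)] with [c > 0] depending on [L] only. A large [q] therefore pays for all
    losses, and the same [q] makes [N] close to the square root of the modulus. *)

Lemma binary_onesE n m : (n <= m)%N ->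
  binary_ones n = (\sum_(0 <= i < m) odd (n %/ 2 ^ i))%N.
Proof.
move=> le_nm; rewrite /binary_ones -sum1dep_card big_mkcond /=.
rewrite (big_cat_nat (n := n)) //= [X in (_ + X)%N]big1_seq ?addn0.
  by rewrite big_mkord; apply: eq_bigr => i _; case: odd.
move=> i; rewrite mem_index_iota => /andP[_ /andP[le_ni _]].
have lt_n2 : (n < 2 ^ i)%N by apply: leq_ltn_trans le_ni (ltn_expl i _).
by rewrite divn_small.
Qed.

Lemma binary_ones_double (b : bool) n :
  binary_ones (b + n.*2) = (b + binary_ones n)%N.
Proof.
rewrite (@binary_onesE _ (b + n.*2).+1) // big_nat_recl // expn0 divn1.
rewrite oddD odd_double addbF oddb; congr addn.
rewrite (@binary_onesE n (b + n.*2)); last by case: b; lia.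
apply: eq_bigr => i _; rewrite expnS divnMA; congr (nat_of_bool (odd (_ %/ _))).
by case: b => /=; lia.
Qed.

Section ThueMorse.
Variable R : realFieldType.

Definition tau n : R := (-1) ^+ binary_ones n.

Lemma tau0 : tau 0 = 1.
Proof. by rewrite /tau (@binary_onesE 0 0) // big_geq. Qed.

Lemma tau_sqr n : tau n * tau n = 1.
Proof. by rewrite /tau -expr2 sqrr_sign. Qed.

Lemma tau_norm n : `|tau n| = 1.
Proof. by rewrite /tau normrX normrN normr1 expr1n. Qed.

Lemma tau_double (b : bool) n : tau (b + n.*2) = (-1) ^+ b * tau n.
Proof. by rewrite /tau binary_ones_double exprD. Qed.

Lemma tau_split k a b : (b < 2 ^ k)%N -> tau (2 ^ k * a + b) = tau a * tau b.
Proof.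
elim: k a b => [|k IHk] a b lt_b.
  by case: b lt_b => // _; rewrite mul1n addn0 tau0 mulr1.
have lt_b2 : (b./2 < 2 ^ k)%N by move: lt_b; rewrite expnS; lia.
have -> : (2 ^ k.+1 * a + b = odd b + (2 ^ k * a + b./2).*2)%N.
  by rewrite expnS; lia.
rewrite tau_double IHk // -{3}(odd_double_half b) tau_double; ring.
Qed.

Lemma tau_divn k n : tau n = tau (n %/ 2 ^ k) * tau (n %% 2 ^ k).
Proof.
by rewrite -(@tau_split k) ?ltn_mod ?expn_gt0 // mulnC -divn_eq.
Qed.

Lemma tau_exp2 k : tau (2 ^ k) = -1.
Proof.
rewrite -(addn0 (2 ^ k)%N) -(muln1 (2 ^ k)%N) tau_split ?expn_gt0 // tau0 mulr1.
by rewrite -[1%N]/(true + 0.*2)%N tau_double tau0 mulr1 expr1.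
Qed.

(** As [2 ^ k - g] and [g.-1] add up to [2 ^ k - 1], their [k] binary digits are complementary. *)
Lemma tau_compl k g : (0 < g <= 2 ^ k)%N ->
  tau (2 ^ k - g) = (-1) ^+ k * tau g.-1.
Proof.
elim: k g => [|k IHk] g /andP[g0 le_g].
  have -> : g = 1%N by move: le_g; rewrite expn0; lia.
  by rewrite expn0 subnn mul1r.
have h : (2 ^ k.+1 - g = ~~ odd g.-1 + (2 ^ k - (g.-1)./2.+1).*2)%N.
  by move: le_g; rewrite expnS; lia.
rewrite h tau_double IHk; last by move: le_g; rewrite expnS; lia.
rewrite /= -{3}(odd_double_half g.-1) tau_double exprS.
by case: odd => /=; ring.
Qed.
End ThueMorse.

(** * Digit recursion and cancellation *)

Lemma mul_add_bound K M (y : 'I_M) (x : 'I_K) : (K * y + x < K * M)%N.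
Proof.
rewrite (@leq_trans (K * y.+1)%N) ?leq_mul2l ?ltn_ord ?orbT //.
by rewrite mulnS addnC ltn_add2r.
Qed.

Definition ord_pair K M (x : 'I_K) (y : 'I_M) := Ordinal (mul_add_bound y x).

Lemma ord_quot_bound K M (z : 'I_(K * M)) : (z %/ K < M)%N.
Proof.
case: K z => [|K] z; first by case: z.
by rewrite ltn_divLR // [X in (_ < X)%N]mulnC.
Qed.

Lemma ord_rem_bound K M (z : 'I_(K * M)) : (z %% K < K)%N.
Proof. by case: K z => [|K] z; [case: z | rewrite ltn_mod]. Qed.

Definition ord_quot K M (z : 'I_(K * M)) := Ordinal (ord_quot_bound z).
Definition ord_rem K M (z : 'I_(K * M)) := Ordinal (ord_rem_bound z).

Lemma ord_remK K M (x : 'I_K) (y : 'I_M) : ord_rem (ord_pair x y) = x.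
Proof. by apply: val_inj => /=; rewrite mulnC modnMDl modn_small. Qed.

Lemma ord_quotK K M (x : 'I_K) (y : 'I_M) : ord_quot (ord_pair x y) = y.
Proof.
apply: val_inj => /=; rewrite mulnC divnMDl ?divn_small ?addn0 //.
by case: (K) x => [[]|].
Qed.

Lemma ord_pairK K M (z : 'I_(K * M)) : ord_pair (ord_rem z) (ord_quot z) = z.
Proof. by apply: val_inj => /=; rewrite mulnC -divn_eq. Qed.

Lemma sum_ord_split (V : nmodType) K M (F : nat -> V) :
  \sum_(z < K * M) F z = \sum_(x < K) \sum_(y < M) F (K * y + x)%N.
Proof.
rewrite pair_big /=.
rewrite (reindex (fun p : 'I_K * 'I_M => ord_pair p.1 p.2)) //=.
exists (fun z => (ord_rem z, ord_quot z)) => [[x y] _ | z _] /=.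
  by rewrite ord_remK ord_quotK.
exact: ord_pairK.
Qed.

Lemma sum_ffun_split (V : nmodType) s K M (F : {ffun 'I_s -> nat} -> V) :
  \sum_(e : {ffun 'I_s -> 'I_(K * M)}) F [ffun i => e i : nat] =
  \sum_(d : {ffun 'I_s -> 'I_K}) \sum_(y : {ffun 'I_s -> 'I_M})
     F [ffun i => K * y i + d i]%N.
Proof.
rewrite pair_big /=.
rewrite (reindex (fun p : {ffun 'I_s -> 'I_K} * {ffun 'I_s -> 'I_M} =>
  [ffun i => ord_pair (p.1 i) (p.2 i)])) /=.
  apply: eq_bigr => p _; congr F; apply/ffunP => i; by rewrite !ffunE.
exists (fun z => ([ffun i => ord_rem (z i)], [ffun i => ord_quot (z i)])).
  move=> [x y] _ /=; congr pair; apply/ffunP => i; rewrite !ffunE /=.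
    by rewrite ord_remK.
  by rewrite ord_quotK.
by move=> z _ /=; apply/ffunP => i; rewrite !ffunE ord_pairK.
Qed.

Section Contraction.
Variable R : realFieldType.

Lemma tau_mod_split k M a v :
  tau R ((2 ^ k * a + v) %% (2 ^ k * M)) =
  tau R ((a + v %/ 2 ^ k) %% M) * tau R (v %% 2 ^ k).
Proof.
case: M => [|M].
  by rewrite muln0 !modn0 {1}(divn_eq v (2 ^ k)) addnA (mulnC (v %/ _)%N) -mulnDr
    tau_split ?ltn_mod ?expn_gt0.
rewrite -(@tau_split _ k) ?ltn_mod ?expn_gt0 //; congr tau.
rewrite {1}(divn_eq v (2 ^ k)) addnA (mulnC (v %/ _)%N) -mulnDr.
set u := (a + _)%N; rewrite {1}(divn_eq u M.+1) mulnDr mulnCA -addnA modnMDl.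
rewrite modn_small // (@leq_trans (2 ^ k * (u %% M.+1).+1)%N) //.
  by rewrite mulnS addnC ltn_add2r ltn_mod expn_gt0.
by rewrite leq_mul2l ltn_pmod ?orbT.
Qed.

(** [c w] is the carry that the digits already split off hand over to the form indexed by [w]; the
    recursion starts with [c = 0]. *)
Definition cube_value s (c : {ffun 'I_s -> bool} -> nat)
    (e : {ffun 'I_s -> nat}) (w : {ffun 'I_s -> bool}) : nat :=
  (\sum_i w i * e i + c w)%N.

Definition cube_inner M s c (e : {ffun 'I_s -> nat}) : R :=
  \sum_(m < M) \prod_w tau R ((m + cube_value c e w) %% M).

Definition cube_sum M s c : R :=
  \sum_(e : {ffun 'I_s -> 'I_M}) `|@cube_inner M s c [ffun i => e i : nat]|.

Definition cube_carry k s c (d : {ffun 'I_s -> nat}) d0 w : nat :=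
  (d0 + cube_value c d w) %/ 2 ^ k.

Definition cube_sign k s c (d : {ffun 'I_s -> nat}) d0 : R :=
  \prod_w tau R ((d0 + cube_value c d w) %% 2 ^ k).

Lemma cube_inner_split k M s c (d y : {ffun 'I_s -> nat}) :
  cube_inner (2 ^ k * M) c [ffun i => 2 ^ k * y i + d i]%N =
  \sum_(d0 < 2 ^ k) cube_sign k c d d0 * cube_inner M (cube_carry k c d d0) y.
Proof.
rewrite /cube_inner
  (sum_ord_split _ _ (fun m => \prod_w tau R ((m + cube_value c _ w) %% _))).
apply: eq_bigr => d0 _; rewrite mulr_sumr; apply: eq_bigr => m _.
rewrite -big_split /=; apply: eq_bigr => w _.
rewrite mulrC; have -> : (2 ^ k * m + d0 +
    cube_value c [ffun i => 2 ^ k * y i + d i] w =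
    2 ^ k * (m + \sum_i w i * y i) + (d0 + cube_value c d w))%N.
  rewrite /cube_value mulnDr big_distrr /=.
  under eq_bigr => i _ do rewrite ffunE mulnDr mulnCA.
  rewrite big_split /=; lia.
by rewrite tau_mod_split -addnA.
Qed.

(** Leaving the full cube loses at least one coordinate, worth [s + 2], and a carry of at most
    [s + 1] cannot make up for it. *)
Lemma full_cube_max s (c : {ffun 'I_s -> bool} -> nat)
    (w : {ffun 'I_s -> bool}) : (forall w, (c w <= s.+1)%N) ->
  w != [ffun=> true] ->
  (cube_value c [ffun=> s.+2] w < cube_value c [ffun=> s.+2] [ffun=> true])%N.
Proof.
move=> c_le; rewrite /cube_value => w_neq.
have [i0 wi0] : exists i0, ~~ w i0.
  apply/existsP; apply: contraR w_neq; rewrite negb_exists => /forallP h.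
  by apply/eqP/ffunP => i; rewrite ffunE; move: (h i); rewrite negbK.
rewrite [X in (_ < X + _)%N](bigD1 i0) // [X in (X + _ < _)%N](bigD1 i0) //=.
rewrite (negbTE wi0) !ffunE mul0n mul1n add0n.
apply: (@leq_ltn_trans (\sum_(i < s | i != i0)
    ([ffun=> true] : {ffun 'I_s -> bool}) i * [ffun=> s.+2] i + s.+1)%N).
  rewrite leq_add //; apply: leq_sum => i _; rewrite !ffunE mul1n.
  by case: (w i); rewrite ?mul1n ?mul0n.
by rewrite [X in (X < _)%N]addnC -addSn leq_addr.
Qed.

(** The bound [s + 1] reproduces itself: [s + 1] digits of size at most [2 ^ k - 1] and a carry of
    at most [s + 1] add up to at most [(s + 1) * 2 ^ k]. So only finitely many states occur,
    independently of the number of blocks. *)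
Lemma cube_carry_bound s (c : {ffun 'I_s -> bool} -> nat) k
    (d : {ffun 'I_s -> nat}) d0 w : (forall w, (c w <= s.+1)%N) ->
  (forall i, (d i < 2 ^ k)%N) -> (d0 < 2 ^ k)%N ->
  (cube_carry k c d d0 w <= s.+1)%N.
Proof.
move=> c_le d_lt d0_lt; rewrite /cube_carry /cube_value.
have h : (\sum_i w i * d i <= s * (2 ^ k).-1)%N.
  rewrite -[X in (_ <= X * _)%N]card_ord -sum_nat_const.
  apply: leq_sum => i _; rewrite -ltnS prednK ?expn_gt0 //.
  by move: (d_lt i); case: (w i); rewrite ?mul1n // mul0n expn_gt0.
rewrite -ltnS ltn_divLR ?expn_gt0 //.
move: (c_le w) d0_lt h; set K := (2 ^ k)%N; nia.
Qed.

(* With all digits of the [e i] equal to [s + 2], the form at the full cube is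
   strictly the largest. The digits of [m] are chosen so that it becomes [2 ^ K]
   while all other forms stay below; passing from [K] to [K + 1] changes the
   sign of each of the remaining [2 ^ s - 1] factors, and creates no carry. *)
Lemma cube_cancel s k c : (0 < s)%N -> (forall w, (c w <= s.+1)%N) ->
  (s.+2 * s.+2 * 4 <= 2 ^ k)%N ->
  exists (d : {ffun 'I_s -> 'I_(2 ^ k)}) (m1 m2 : 'I_(2 ^ k)), [/\ m1 != m2,
    cube_carry k c [ffun i => d i : nat] m1 =1
    cube_carry k c [ffun i => d i : nat] m2 &
    cube_sign k c [ffun i => d i : nat] m1 =
    - cube_sign k c [ffun i => d i : nat] m2].
Proof.
move=> s_gt0 c_le le_k.
have [K def_k] : exists K, k = K.+2.
  case: k le_k => [|[|k]] h; last by exists k.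
  - by move: h; rewrite expn0; nia.
  - by move: h; rewrite expn1; nia.
have le_K : (s.+2 * s.+2 <= 2 ^ K)%N by move: le_k; rewrite def_k !expnS; lia.
have lt_sk : (s.+2 < 2 ^ k)%N by move: le_k; nia.
pose V := cube_value c [ffun=> s.+2]; pose V0 := V [ffun=> true].
have V0_le : (0 < V0 <= 2 ^ K)%N.
  rewrite /V0 /V /cube_value.
  under eq_bigr => i _ do rewrite !ffunE mul1n.
  rewrite sum_nat_const card_ord; move: (c_le [ffun=> true]) le_K s_gt0; nia.
have V_le w : (V w <= V0)%N.
  have [->//|w_neq] := eqVneq w [ffun=> true].
  by apply: ltnW; apply: full_cube_max.
have m_lt j : (j <= 1)%N -> (2 ^ (K + j) - V0 < 2 ^ k)%N.
  move=> j_le; apply: leq_ltn_trans (leq_subr _ _) _.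
  by rewrite ltn_exp2l // def_k; lia.
exists [ffun=> Ordinal lt_sk], (Ordinal (m_lt 0 isT)), (Ordinal (m_lt 1 isT)).
have -> : [ffun i => ([ffun=> Ordinal lt_sk] : {ffun 'I_s -> 'I_(2 ^ k)}) i : nat]
   = [ffun=> s.+2] by apply/ffunP => i; rewrite !ffunE.
have eK j : (j <= 1)%N -> (V0 <= 2 ^ (K + j))%N.
  by move=> _; rewrite expnD; have := expn_gt0 2 j; nia.
have small j w : (j <= 1)%N ->
    (2 ^ (K + j) - V0 + V w)%N = (2 ^ (K + j) - (V0 - V w))%N /\
    (2 ^ (K + j) - V0 + V w < 2 ^ k)%N.
  move=> j_le; have := V_le w; have := eK j j_le => h1 h2; split; first by lia.
  apply: (@leq_ltn_trans (2 ^ (K + j))%N); first by lia.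
  by rewrite ltn_exp2l // def_k; lia.
split.
- rewrite -val_eqE /= addn0 addn1 expnS; move: V0_le; lia.
- move=> w; rewrite /cube_carry -/V /= !divn_small //.
    by case: (small 1%N w isT).
  by case: (small 0%N w isT).
rewrite /cube_sign -/V /=.
have sgnE j : (j <= 1)%N -> \prod_w tau R ((2 ^ (K + j) - V0 + V w) %% 2 ^ k) =
   - ((-1) ^+ (K + j)) * \prod_(w | w != [ffun=> true]) tau R (V0 - V w).-1.
  move=> j_le; rewrite (bigD1 [ffun=> true]) //= -/V0 subnK ?eK //.
  rewrite modn_small ?ltn_exp2l //; last by rewrite def_k; lia.
  rewrite tau_exp2 mulN1r mulNr; congr (- _).
  transitivity (\prod_(w : {ffun 'I_s -> bool} | w != [ffun=> true])
     ((-1) ^+ (K + j) * tau R (V0 - V w).-1)).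
    apply: eq_bigr => w w_neq; have [e lt_w] := small j w j_le.
    rewrite modn_small // e tau_compl // subn_gt0 full_cube_max //=.
    exact: leq_trans (leq_subr _ _) (eK j j_le).
  rewrite big_split /= prodr_const; congr (_ * _).
  rewrite -exprM -[LHS]signr_odd oddM; set n := #|_|.
  have -> : odd n = true.
    have := cardC (pred1 ([ffun=> true] : {ffun 'I_s -> bool})).
    rewrite card1 card_ffun card_bool card_ord (@eq_card _ (predC _)
      (fun w => w != [ffun=> true])) => [h|w]; last by rewrite !inE.
    have {h} : odd (1 + n) = false by rewrite h oddX; case: (s) s_gt0.
    by rewrite oddD /= => /negbFE.
  by rewrite andbT signr_odd.
rewrite !sgnE // addn0 addn1 exprS; ring.
Qed.

(** The triangle inequality is applied over the [(2 ^ k) ^ (s + 1)] choices of the lowest digits of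
    [e] and [m]. For the digits [d] given by [cube_cancel], the terms of [m1] and [m2] have equal
    carries and opposite signs, so they cancel before norms are taken; this is the [- 2]. *)
Lemma cube_sum_step s k M c (B : R) : (0 < s)%N ->
  (s.+2 * s.+2 * 4 <= 2 ^ k)%N ->
  (forall c, (forall w, (c w <= s.+1)%N) -> @cube_sum M s c <= B) ->
  (forall w, (c w <= s.+1)%N) ->
  @cube_sum (2 ^ k * M) s c <= ((2 ^ k)%:R ^+ s.+1 - 2) * B.
Proof.
move=> s_gt0 le_k IH c_le.
have [d [m1 [m2 [m_neq eq_carry eq_sign]]]] := cube_cancel s_gt0 c_le le_k.
rewrite /cube_sum
  (sum_ffun_split _ _ (fun e => `|cube_inner (2 ^ k * M) c e|)) /=.
pose S (d : {ffun 'I_s -> 'I_(2 ^ k)}) (P : pred 'I_(2 ^ k)) :=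
  \sum_(d0 | P d0) @cube_sum M s (cube_carry k c [ffun i => d i : nat] d0).
have S_le d' (P : pred 'I_(2 ^ k)) : S d' P <= #|P|%:R * B.
  rewrite /S -[#|P|]sum1_card natr_sum mulr_suml; apply: ler_sum => d0 _.
  rewrite mul1r; apply: IH => w; apply: cube_carry_bound => // i.
  by rewrite ffunE.
have inner (P : pred 'I_(2 ^ k)) (d' : {ffun 'I_s -> 'I_(2 ^ k)}) :
  \sum_(y : {ffun 'I_s -> 'I_M}) `|\sum_(d0 | P d0)
    cube_sign k c [ffun i => d' i : nat] d0 *
    cube_inner M (cube_carry k c [ffun i => d' i : nat] d0) [ffun i => y i : nat]|
  <= S d' P.
  rewrite /S /cube_sum exchange_big /=; apply: ler_sum => y _.
  apply: le_trans (ler_norm_sum _ _ _) _; apply: ler_sum => d0 _.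
  rewrite normrM [ `|cube_sign _ _ _ _|]normr_prod big1 ?mul1r // => w _.
  exact: tau_norm.
have splitE (d' : {ffun 'I_s -> 'I_(2 ^ k)}) (y : {ffun 'I_s -> 'I_M}) :
   cube_inner (2 ^ k * M) c [ffun i => 2 ^ k * y i + d' i]%N =
   \sum_(d0 < 2 ^ k) cube_sign k c [ffun i => d' i : nat] d0 *
    cube_inner M (cube_carry k c [ffun i => d' i : nat] d0) [ffun i => y i : nat].
  rewrite -cube_inner_split; congr cube_inner.
  by apply/ffunP => i; rewrite !ffunE.
rewrite (bigD1 d) //=.
have -> : ((2 ^ k)%:R ^+ s.+1 - 2) * B =
  ((2 ^ k)%:R - 2) * B + ((2 ^ k)%:R ^+ s - 1) * ((2 ^ k)%:R * B) :> R.
  by rewrite exprS; ring.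
apply: lerD.
  pose P := [pred x : 'I_(2 ^ k) | (x != m1) && (x != m2)].
  have cardP : #|P|%:R = (2 ^ k)%:R - 2 :> R.
    have := cardC P; rewrite card_ord (@eq_card _ (predC P) (pred2 m1 m2)).
      by rewrite card2 m_neq => /(congr1 (fun n => n%:R : R)) <-; rewrite natrD addrK.
    by move=> x; rewrite !inE negb_and !negbK.
  rewrite -cardP; apply: le_trans (S_le d P); apply: le_trans (inner P d).
  apply: ler_sum => y _; rewrite splitE (bigD1 m1) //= (bigD1 m2) 1?eq_sym //=.
  rewrite eq_sign mulNr.
  have -> : cube_inner M (cube_carry k c [ffun i => d i : nat] m1)
      [ffun i => y i : nat] = cube_inner M (cube_carry k c [ffun i => d i : nat] m2)
      [ffun i => y i : nat].
    rewrite /cube_inner; apply: eq_bigr => m _; apply: eq_bigr => w _.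
    by rewrite /cube_value eq_carry.
  by rewrite addKr.
apply: (@le_trans _ _ (\sum_(d' | d' != d) (2 ^ k)%:R * B)).
  apply: ler_sum => d' _; have := S_le d' predT; rewrite card_ord.
  apply: le_trans; apply: le_trans (inner predT d').
  by apply: ler_sum => y _; rewrite splitE.
rewrite sumr_const -[_ *+ _]mulr_natl; set n := #|_|.
suff -> : n%:R = (2 ^ k)%:R ^+ s - 1 :> R by [].
have := cardC (pred1 d); rewrite card1 card_ffun !card_ord.
rewrite (@eq_card _ (predC _) (fun x => x != d)) => [h|x]; last by rewrite !inE.
by rewrite -natrX -h natrD addrC addKr.
Qed.

Lemma cube_sum_bound s k j c : (0 < s)%N ->
  (s.+2 * s.+2 * 4 <= 2 ^ k)%N -> (forall w, (c w <= s.+1)%N) ->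
  @cube_sum (2 ^ (k * j)) s c <= ((2 ^ k)%:R ^+ s.+1 - 2) ^+ j.
Proof.
move=> s_gt0 le_k; elim: j c => [|j IHj] c c_le.
  rewrite muln0 expn0 expr0 /cube_sum.
  rewrite (eq_bigr (fun=> 1)).
    by rewrite sumr_const card_ffun !card_ord exp1n.
  move=> e _; rewrite /cube_inner big_ord1 normr_prod big1 // => w _.
  exact: tau_norm.
by rewrite mulnS expnD exprS; apply: cube_sum_step.
Qed.
End Contraction.

(** * Gowers averages on finite abelian groups *)

Section Averages.
Variables (R : realFieldType) (G : finZmodType).
Implicit Types F f : G -> R.

Definition avg F : R := (\sum_x F x) / #|G|%:R.

Lemma cardG_neq0 : #|G|%:R != 0 :> R.
Proof. by rewrite pnatr_eq0 -lt0n; apply/card_gt0P; exists 0. Qed.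

Lemma eq_avg F1 F2 : F1 =1 F2 -> avg F1 = avg F2.
Proof. by move=> h; rewrite /avg (eq_bigr F2). Qed.

Lemma avg_const c : avg (fun=> c) = c.
Proof. by rewrite /avg sumr_const -[c *+ _]mulr_natr mulfK ?cardG_neq0. Qed.

Lemma ler_avg F1 F2 : (forall x, F1 x <= F2 x) -> avg F1 <= avg F2.
Proof. by move=> h; rewrite ler_wpM2r ?invr_ge0 ?ler0n // ler_sum. Qed.

Lemma avg_ge0 F : (forall x, 0 <= F x) -> 0 <= avg F.
Proof. by move=> h; rewrite -(avg_const 0) ler_avg. Qed.

Lemma avg_shift F a : avg (fun x => F (x + a)) = avg F.
Proof.
rewrite /avg [in RHS](reindex_inj (h := fun x => x + a)) //=.
exact: addIr.
Qed.

Lemma avgMl c F : avg (fun x => c * F x) = c * avg F.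
Proof. by rewrite /avg mulrA mulr_sumr. Qed.

Lemma avgD F1 F2 : avg (fun x => F1 x + F2 x) = avg F1 + avg F2.
Proof. by rewrite /avg big_split mulrDl. Qed.

Lemma exchange_avg (F : G -> G -> R) :
  avg (fun x => avg (F x)) = avg (fun y => avg (F^~ y)).
Proof. by rewrite /avg -!mulr_suml exchange_big. Qed.

Lemma avg_norm F : `|avg F| <= avg (fun x => `|F x|).
Proof.
rewrite /avg normrM [ `|_^-1|]ger0_norm ?invr_ge0 ?ler0n //.
by rewrite ler_wpM2r ?invr_ge0 ?ler0n // ler_norm_sum.
Qed.

Lemma avg_sqr F : avg F ^+ 2 = avg (fun e => avg (fun x => F x * F (x + e))).
Proof.
rewrite exchange_avg expr2 -avgMl; apply: eq_avg => x.
rewrite avgMl mulrC; congr (_ * _); rewrite -(avg_shift F x).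
by apply: eq_avg => y; rewrite addrC.
Qed.

Lemma avg_sqr_le F : avg F ^+ 2 <= avg (fun x => F x ^+ 2).
Proof.
have : 0 <= avg (fun x => (F x - avg F) ^+ 2).
  by apply: avg_ge0 => x; apply: sqr_ge0.
rewrite (@eq_avg _ (fun x => F x ^+ 2 + ((- 2 * avg F) * F x + avg F ^+ 2))).
  by rewrite !avgD avgMl avg_const; nra.
by move=> x; ring.
Qed.

Lemma avg_jensen F n : (forall x, 0 <= F x) ->
  avg F ^+ (2 ^ n) <= avg (fun x => F x ^+ (2 ^ n)).
Proof.
move=> F_ge0; elim: n => [|n IHn]; first by rewrite expn0 expr1.
rewrite expnSr exprM.
apply: (@le_trans _ _ (avg (fun x => F x ^+ (2 ^ n)) ^+ 2)).
  by rewrite lerXn2r ?nnegrE ?exprn_ge0 ?avg_ge0 // => x; rewrite exprn_ge0.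
apply: le_trans (avg_sqr_le _) _; apply: ler_avg => x.
by rewrite exprM.
Qed.

(* Unlike the Gowers norm, the innermost average is taken in absolute value,
   which makes every level nonnegative. *)
Fixpoint gowers s f : R :=
  if s is s'.+1 then avg (fun e => gowers s' (fun x => f x * f (x + e)))
  else `|avg f|.

Lemma gowers_ge0 s f : 0 <= gowers s f.
Proof. by elim: s f => [|s IHs] f //=; apply: avg_ge0. Qed.

(** Substitute for the invertibility of [a - b], which fails modulo a power of 2 when [a - b] is
    even: the multiples of [a - b] may miss part of the group, but each value is taken at most [B]
    times. *)
Definition fibre_bound (B : nat) a b := forall F, (forall x, 0 <= F x) ->
  avg (fun e => F (e *+ a - e *+ b)) <= B%:R * avg F.

(** Each Cauchy-Schwarz removes one factor. After translating [m] by [- d *+ b], the factor [f b]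
    depends on [m] alone and is bounded by 1. Squaring the inner average over [d] brings in a
    difference [e], which shifts the factor of index [c] by [e *+ c - e *+ b]. For [f0] the shift is
    [e *+ a - e *+ b], and the fibre bound turns it into a free variable, that is, into one more
    level of the norm. *)
Lemma von_neumann B (bs : seq nat) (f : nat -> G -> R) f0 a :
  (forall b x, `|f b x| <= 1) -> {in bs, forall b, fibre_bound B a b} ->
  `|avg (fun m => avg (fun d =>
      f0 (m + d *+ a) * \prod_(b <- bs) f b (m + d *+ b)))| ^+ (2 ^ size bs)
  <= B%:R ^+ size bs * gowers (size bs) f0.
Proof.
elim: bs f f0 => [|b bs IHbs] f f0 f_le hB /=.
  rewrite expn0 expr1 expr0 mul1r le_eqVlt exchange_avg; apply/orP; left.
  apply/eqP; congr (`|_|); rewrite -[RHS]avg_const; apply: eq_avg => d.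
  rewrite -[RHS](avg_shift _ (d *+ a)); apply: eq_avg => m.
  by rewrite big_nil mulr1.
pose Phi m d := f0 (m - d *+ b + d *+ a) *
  \prod_(c <- bs) f c (m - d *+ b + d *+ c).
pose f0' e x := f0 x * f0 (x + (e *+ a - e *+ b)).
pose f' e c x := f c x * f c (x + (e *+ c - e *+ b)).
pose E e := avg (fun m => avg (fun d =>
  f0' e (m + d *+ a) * \prod_(c <- bs) f' e c (m + d *+ c))).
set E0 := avg _.
have E0_eq : E0 = avg (fun m => f b m * avg (Phi m)).
  rewrite /E0 exchange_avg.
  rewrite (@eq_avg _ (fun d => avg (fun m => f b m * Phi m d))).
    by rewrite exchange_avg; apply: eq_avg => m; rewrite avgMl.
  move=> d; rewrite -(avg_shift _ (- (d *+ b))); apply: eq_avg => m.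
  by rewrite big_cons /Phi subrK mulrCA.
have E0_le : `|E0| ^+ 2 <= avg (fun e => `|E e|).
  apply: (@le_trans _ _ (avg (fun m => `|avg (Phi m)|) ^+ 2)).
    rewrite lerXn2r ?nnegrE ?avg_ge0 // E0_eq.
    apply: le_trans (avg_norm _) _; apply: ler_avg => m.
    by rewrite normrM ler_piMl.
  apply: le_trans (avg_sqr_le _) _.
  rewrite (@eq_avg _ (fun m => avg (fun e =>
      avg (fun d => Phi m d * Phi m (d + e))))); last first.
    by move=> m; rewrite real_normK ?num_real // avg_sqr.
  rewrite exchange_avg; apply: ler_avg => e.
  apply: le_trans (ler_norm _) _; rewrite le_eqVlt; apply/orP; left.
  apply/eqP; congr (`|_|); rewrite /E exchange_avg [in RHS]exchange_avg.
  apply: eq_avg => d; rewrite -(avg_shift _ (d *+ b)); apply: eq_avg => m.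
  rewrite /Phi /f0' /f' big_split /= addrK mulrACA.
  have eqP c : m + d *+ b - (d + e) *+ b + (d + e) *+ c =
      m + d *+ c + (e *+ c - e *+ b).
    by rewrite !mulrnDl opprD (addrA (m + d *+ b)) addrK addrAC !addrA.
  rewrite eqP; congr (_ * _ * (_ * _)).
  by apply: eq_bigr => c _; rewrite eqP.
rewrite expnS exprM.
apply: (@le_trans _ _ (avg (fun e => `|E e|) ^+ (2 ^ size bs))).
  by rewrite lerXn2r ?nnegrE ?avg_ge0 // exprn_ge0.
apply: le_trans (avg_jensen _ _) _ => //.
apply: (@le_trans _ _ (avg (fun e =>
   B%:R ^+ size bs * gowers (size bs) (f0' e)))).
  apply: ler_avg => e; apply: IHbs => [c x|c c_in].
    rewrite normrM; apply: le_trans (ler_wpM2l _ (f_le _ _)) _ => //.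
    by rewrite mulr1.
  by apply: hB; rewrite inE c_in orbT.
rewrite avgMl exprSr -mulrA ler_wpM2l ?exprn_ge0 ?ler0n //.
apply: (hB b _ (fun e => gowers (size bs) (fun x => f0 x * f0 (x + e)))).
  by rewrite inE eqxx.
by move=> x; apply: gowers_ge0.
Qed.

(** The norm around the average over [m] prevents a direct use of [von_neumann]. A Cauchy-Schwarz in
    [d] opens it and creates a difference [e] common to all factors; together with [h] this explains
    the two extra levels of the norm. *)
Lemma two_parameter_bound B a (bs : seq nat) f : (forall x, `|f x| <= 1) ->
  {in bs, forall b, fibre_bound B a b} ->
  avg (fun h => avg (fun d => `|avg (fun m =>
    \prod_(c <- a :: bs) (f (m + d *+ c) * f (m + d *+ c + h)))|))
    ^+ (2 ^ (size bs).+1) <= B%:R ^+ size bs * gowers (size bs).+2 f.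
Proof.
move=> f_le hB.
pose T h x := f x * f (x + h).
have T_le h x : `|T h x| <= 1.
  rewrite normrM; apply: le_trans (ler_wpM2l _ (f_le _)) _ => //.
  by rewrite mulr1.
pose P h d m := \prod_(c <- a :: bs) T h (m + d *+ c).
pose E h e := avg (fun m => avg (fun d =>
  T h (m + d *+ a) * T h (m + d *+ a + e) *
  \prod_(c <- bs) (T h (m + d *+ c) * T h (m + d *+ c + e)))).
rewrite -/(T _) /=; apply: le_trans (avg_jensen _ _) _.
  by move=> h; apply: avg_ge0.
apply: (@le_trans _ _ (avg (fun h => avg (fun e =>
   B%:R ^+ size bs * gowers (size bs) (fun x => T h x * T h (x + e)))))).
  apply: ler_avg => h; rewrite expnS exprM.
  apply: (@le_trans _ _ (avg (fun e => `|E h e|) ^+ (2 ^ size bs))).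
    rewrite lerXn2r ?nnegrE ?avg_ge0 ?exprn_ge0 ?avg_ge0 //.
    apply: le_trans (avg_sqr_le _) _.
    rewrite (@eq_avg _ (fun d => avg (fun e =>
        avg (fun m => P h d m * P h d (m + e))))); last first.
      by move=> d; rewrite real_normK ?num_real // -/(P h d) avg_sqr.
    rewrite exchange_avg; apply: ler_avg => e.
    apply: le_trans (ler_norm _) _; rewrite le_eqVlt; apply/orP; left.
    apply/eqP; congr (`|_|); rewrite /E exchange_avg.
    apply: eq_avg => m; apply: eq_avg => d.
    rewrite /P -big_split /= big_cons (addrAC m).
    by congr (_ * _); apply: eq_bigr => c _; rewrite (addrAC m).
  apply: le_trans (avg_jensen _ _) _ => //; apply: ler_avg => e.
  apply: (@von_neumann B bs (fun c x => T h x * T h (x + e))) => // c x.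
  rewrite normrM; apply: le_trans (ler_wpM2l _ (T_le _ _)) _ => //.
  by rewrite mulr1.
rewrite le_eqVlt; apply/orP; left; apply/eqP.
by rewrite -avgMl; apply: eq_avg => h; rewrite /= -avgMl.
Qed.
End Averages.

(** * Cyclic groups and the Gowers average of the digit sign *)

Definition fcons (T : Type) s (x : T) (f : {ffun 'I_s -> T}) :
    {ffun 'I_s.+1 -> T} :=
  [ffun i => if unlift ord0 i is Some j then f j else x].

Lemma big_ffunS (V : Type) (idx : V) (op : Monoid.com_law idx) (T : finType) s
    (F : {ffun 'I_s.+1 -> T} -> V) :
  \big[op/idx]_(e : {ffun 'I_s.+1 -> T}) F e =
  \big[op/idx]_(x : T) \big[op/idx]_(e : {ffun 'I_s -> T}) F (fcons x e).
Proof.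
rewrite pair_big /=.
rewrite (reindex (fun p : T * {ffun 'I_s -> T} => fcons p.1 p.2)) //=.
exists (fun e => (e ord0, [ffun j => e (lift ord0 j)])) => [[x e] _ | e _] /=.
  congr pair; first by rewrite ffunE unlift_none.
  by apply/ffunP => j; rewrite !ffunE liftK.
apply/ffunP => i; rewrite ffunE; case: unliftP => [j ->|-> //].
by rewrite ffunE.
Qed.

Lemma big_ffun0 (V : Type) (idx : V) (op : Monoid.com_law idx) (T : finType)
    (F : {ffun 'I_0 -> T} -> V) e0 :
  \big[op/idx]_(e : {ffun 'I_0 -> T}) F e = F e0.
Proof. by rewrite (big_pred1 e0) // => e; apply/esym/eqP/ffunP => -[]. Qed.

Section CyclicGroup.
Variables (R : realFieldType) (n : nat).
Local Notation G := 'I_n.+1.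

Lemma gowers_cube s (f : G -> R) :
  gowers s f = (\sum_(e : {ffun 'I_s -> G}) `|\sum_m \prod_(w : {ffun 'I_s -> bool})
     f (m + \sum_i e i *+ w i)|) / n.+1%:R ^+ s.+1.
Proof.
elim: s f => [|s IHs] f.
  rewrite (big_ffun0 _ _ [ffun=> 0]) expr1 /= /avg card_ord normrM.
  rewrite [ `|_^-1|]ger0_norm ?invr_ge0 ?ler0n //; congr (`|_| / _).
  apply: eq_bigr => m _; rewrite (big_ffun0 _ _ [ffun=> false]).
  by rewrite big_ord0 addr0.
rewrite /= /avg card_ord exprSr invfM mulrA; congr (_ / _).
rewrite (eq_bigr _ (fun e _ => IHs _)) -mulr_suml; congr (_ / _).
rewrite big_ffunS; apply: eq_bigr => x _; apply: eq_bigr => e _.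
congr (`|_|); apply: eq_bigr => m _; rewrite big_ffunS big_bool big_split /=.
rewrite mulrC; congr (_ * _); apply: eq_bigr => w _;
  rewrite big_ord_recl !ffunE unlift_none.
  rewrite mulr1n [x + _]addrC addrA.
  by congr (f (_ + _ + _)); apply: eq_bigr => i _; rewrite !ffunE liftK.
rewrite mulr0n add0r.
by congr (f (_ + _)); apply: eq_bigr => i _; rewrite !ffunE liftK.
Qed.

Lemma inZpD a b : inZp (a + b) = inZp a + inZp b :> G.
Proof. by apply: val_inj; rewrite /= modnDm. Qed.

Lemma val_linear_form s (m : G) (e : {ffun 'I_s -> G}) (w : {ffun 'I_s -> bool}) :
  val (m + \sum_i e i *+ w i) = ((m + \sum_i w i * e i) %% n.+1)%N.
Proof.
have -> : m + \sum_i e i *+ w i = inZp (m + \sum_i w i * e i).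
  rewrite inZpD valZpK; congr (_ + _).
  rewrite (big_morph (inZp : nat -> G) inZpD (id1 := 0)); last exact: val_inj.
  by apply: eq_bigr => i _; rewrite Zp_mulrn mulnC.
by [].
Qed.

Lemma gowers_tau s : gowers s (fun x : G => tau R x) =
  cube_sum R n.+1 (fun _ : {ffun 'I_s -> bool} => 0%N) / n.+1%:R ^+ s.+1.
Proof.
rewrite gowers_cube; congr (_ / _); apply: eq_bigr => e _; congr (`|_|).
apply: eq_bigr => m _; apply: eq_bigr => w _.
rewrite -[nat_of_ord _]/(val _) val_linear_form /cube_value addn0.
by congr (tau R ((_ + _) %% _)); apply: eq_bigr => i _; rewrite ffunE.
Qed.

(** The residue of [e * c] modulo [n.+1] is prescribed on the fibre, so [e] is determined by the
    quotient, which is below [c]. *)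
Lemma card_fibre_mul c (y : G) : (0 < c)%N -> (#|[pred e : G | e *+ c == y]| <= c)%N.
Proof.
move=> c_gt0; set A := [pred e : G | _].
have lt_c (e : G) : (e * c %/ n.+1 < c)%N.
  by rewrite ltn_divLR // mulnC ltn_pmul2l.
rewrite -[X in (_ <= X)%N]card_ord.
rewrite -(@card_in_image _ _ (fun e : G => Ordinal (lt_c e)) A) ?max_card //.
move=> e1 e2; rewrite !inE => /eqP <- /eqP; rewrite !Zp_mulrn.
move=> /(congr1 val) /= eq_mod /(congr1 val) /= eq_div; apply: val_inj => /=.
have : (e1 * c = e2 * c)%N.
  by rewrite (divn_eq (e1 * c) n.+1) (divn_eq (e2 * c) n.+1) eq_mod eq_div.
by move/eqP; rewrite eqn_pmul2r // => /eqP.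
Qed.

Lemma fibre_bound_Zp B a b : a != b -> (a <= B)%N -> (b <= B)%N ->
  @fibre_bound R G B a b.
Proof.
move=> neq_ab le_a le_b F F_ge0; rewrite /avg mulrA ler_wpM2r ?invr_ge0 ?ler0n //.
rewrite (partition_big (fun e : G => e *+ a - e *+ b) predT) //= mulr_sumr.
apply: ler_sum => y _; rewrite (eq_bigr (fun=> F y)); last by move=> e /eqP ->.
rewrite sumr_const -[_ *+ _]mulr_natl ler_wpM2r // ler_nat.
have [lt_ab|le_ba] := ltnP a b.
  apply: leq_trans (leq_trans _ le_b); last exact: (leq_subr a b).
  apply: leq_trans (card_fibre_mul (- y) _); last by rewrite subn_gt0.
  apply: subset_leq_card; apply/fintype.subsetP => e /eqP/val_inj <-; apply/eqP.
  by rewrite opprB mulrnBr // ltnW.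
apply: leq_trans (leq_trans _ le_a); last exact: (leq_subr b a).
apply: leq_trans (card_fibre_mul y _).
  apply: subset_leq_card; apply/fintype.subsetP => e /eqP/val_inj <-; apply/eqP.
  by rewrite mulrnBr.
by rewrite subn_gt0 ltn_neqAle eq_sym neq_ab.
Qed.
End CyclicGroup.

(** * Correlations of the digit sign in two parameters *)

Section TwoParameters.
Variable R : realFieldType.

(** The correlation of a word with its shift by [e], over a full period. The variable [h] stands for
    [e * d] and is separated from [d], so that both can be averaged independently. *)
Definition corr_sum M (cs : seq nat) d h : R :=
  `|\sum_(m < M) \prod_(c <- cs)
      (tau R ((m + c * d) %% M) * tau R ((m + c * d + h) %% M))|.

Lemma corr_sum_ge0 M cs d h : 0 <= corr_sum M cs d h.
Proof. exact: normr_ge0. Qed.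

Lemma corr_sum_avg M a (bs : seq nat) B : (0 < M)%N -> uniq (a :: bs) ->
  {in a :: bs, forall b, b <= B}%N ->
  ((\sum_(d < M) \sum_(h < M) corr_sum M (a :: bs) d h) / M%:R ^+ 3)
    ^+ (2 ^ (size bs).+1) <=
  B%:R ^+ size bs * (cube_sum R M (fun _ : {ffun 'I_(size bs).+2 -> bool} => 0%N)
     / M%:R ^+ (size bs).+3).
Proof.
case: M => // n _ /= /andP[a_notin _] le_B.
rewrite -gowers_tau.
apply: le_trans (@two_parameter_bound _ _ B a bs (fun x : 'I_n.+1 => tau R x) _ _).
- rewrite le_eqVlt; apply/orP; left; apply/eqP; congr (_ ^+ _).
  rewrite exchange_big /= /avg card_ord mulr_suml mulr_suml; apply: eq_bigr => h _.
  rewrite mulr_suml mulr_suml mulr_suml; apply: eq_bigr => d _.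
  rewrite normrM [ `|_^-1|]ger0_norm ?invr_ge0 ?ler0n //.
  rewrite !exprS expr0 mulr1 !invfM !mulrA; congr (_ / _ / _ / _).
  congr (`|_|); apply: eq_bigr => m _; apply: eq_bigr => c _.
  by rewrite Zp_mulrn /= modnDmr mulnC modnDml.
- by move=> x; rewrite tau_norm.
- move=> b b_in; apply: fibre_bound_Zp.
  + by apply: contraNneq a_notin => ->.
  + by apply: le_B; rewrite inE eqxx.
  + by apply: le_B; rewrite inE b_in orbT.
Qed.

Lemma corr_sum_bound k j a (bs : seq nat) B : uniq (a :: bs) ->
  {in a :: bs, forall b, b <= B}%N ->
  ((size bs).+4 * (size bs).+4 * 4 <= 2 ^ k)%N ->
  ((\sum_(d < 2 ^ (k * j)) \sum_(h < 2 ^ (k * j))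
       corr_sum (2 ^ (k * j)) (a :: bs) d h) / (2 ^ (k * j))%:R ^+ 3)
    ^+ (2 ^ (size bs).+1) <=
  B%:R ^+ size bs * (1 - 2 / (2 ^ k)%:R ^+ (size bs).+3) ^+ j.
Proof.
move=> uniq_bs le_B le_k.
have K0 : (2 ^ k)%:R != 0 :> R by rewrite pnatr_eq0 -lt0n expn_gt0.
apply: le_trans (corr_sum_avg _ uniq_bs le_B) _; first by rewrite expn_gt0.
rewrite ler_wpM2l ?exprn_ge0 // ler_pdivrMr; last first.
  by rewrite exprn_gt0 // ltr0n expn_gt0.
apply: le_trans (@cube_sum_bound R _ k j _ _ _ _) _ => //.
rewrite expnM (natrX _ (2 ^ k) j) -exprM mulnC exprM -exprMn.
by rewrite mulrBl mul1r mulfVK // expf_neq0.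
Qed.
End TwoParameters.

(** * Van der Corput's inequality *)

Section VanDerCorput.
Variable R : realFieldType.

Lemma sum_sqr_le (I : finType) (x : I -> R) :
  (\sum_i x i) ^+ 2 <= #|I|%:R * \sum_i x i ^+ 2.
Proof.
set S := \sum_i x i; set n : R := #|I|%:R.
have [I0|n_gt0] := posnP #|I|.
  rewrite /S big1 ?expr0n ?mulr_ge0 ?sumr_ge0 // => [i _|i _]; first exact: sqr_ge0.
  by have := card0_eq I0 i.
have : 0 <= \sum_i (n * x i - S) ^+ 2 by apply: sumr_ge0 => i _; apply: sqr_ge0.
rewrite (eq_bigr (fun i => n ^+ 2 * x i ^+ 2 + ((- 2 * n * S) * x i + S ^+ 2))).
  rewrite !big_split /= sumr_const -[S ^+ 2 *+ _]mulr_natl -!mulr_sumr -/S -/n.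
  have n0 : 0 < n by rewrite ltr0n.
  set Q := \sum_i _.
  have -> : n ^+ 2 * Q + (- 2 * n * S * S + n * S ^+ 2) = n * (n * Q - S ^+ 2).
    by ring.
  by rewrite pmulr_rge0 // subr_ge0.
by move=> i _; ring.
Qed.

Lemma sum_shift_le (a : nat -> R) N t : (forall n, `|a n| <= 1) ->
  `|\sum_(n < N) a n - \sum_(n < N) a (n + t)%N| <= 2 * t%:R.
Proof.
move=> a_le; elim: t => [|t IHt].
  rewrite (eq_bigr (fun n : 'I_N => a (n + 0)%N)) => [|n _]; last by rewrite addn0.
  by rewrite subrr normr0 mulr0.
have -> : \sum_(n < N) a (n + t.+1)%N =
    \sum_(n < N) a (n + t)%N + (a (N + t)%N - a t).
  apply/(@addrI _ (a t)); rewrite [RHS]addrC -addrA subrK.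
  transitivity (\sum_(n < N.+1) a (n + t)%N).
    by rewrite big_ord_recl; congr (_ + _); apply: eq_bigr => n _; rewrite addnS.
  by rewrite big_ord_recr.
rewrite opprD addrA -[t.+1%:R]natr1 mulrDr mulr1.
apply: le_trans (ler_normB _ _) _; apply: lerD => //.
by apply: le_trans (ler_normB _ _) _; apply: lerD.
Qed.

Lemma coloured_sqr_le K P (col : nat -> nat) (x : nat -> R) :
  (forall i, (i < K)%N -> (col i < P)%N) ->
  (\sum_(i < K) x i) ^+ 2 <=
  P%:R * \sum_(i < K) \sum_(j < K | col i == col j) x i * x j.
Proof.
move=> col_lt; pose c (i : 'I_K) := Ordinal (col_lt i (ltn_ord i)).
have cE (i j : 'I_K) : (c i == c j) = (col i == col j) by [].
rewrite (partition_big c predT) //=.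
apply: le_trans (sum_sqr_le _) _; rewrite card_ord ler_wpM2l // le_eqVlt.
apply/orP; left; apply/eqP; rewrite [RHS](partition_big c predT) //=.
apply: eq_bigr => p _; rewrite expr2 big_distrlr /=; apply: eq_bigr => i /eqP <-.
by apply: eq_bigl => j; rewrite -val_eqE /= eq_sym.
Qed.

Lemma sum_pairs_le K (P : rel nat) (F : nat -> nat -> R) (B : R) :
  (forall i, `|F i i| <= B) -> (forall i j, F i j = F j i) -> symmetric P ->
  \sum_(i < K) \sum_(j < K | P i j) F i j <=
  K%:R * B + 2 * \sum_(i < K) \sum_(j < K | (i < j)%N && P i j) `|F i j|.
Proof.
move=> F_diag F_sym P_sym.
have B_ge0 : 0 <= B by apply: le_trans (F_diag 0%N).
have tri : \sum_(i < K) \sum_(j < K | P i j) F i j <=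
    \sum_(i < K) (\sum_(j < K) (i == j)%:R * B +
      (\sum_(j < K) (if (i < j)%N && P i j then `|F i j| else 0) +
       \sum_(j < K) (if (j < i)%N && P j i then `|F j i| else 0))).
  apply: ler_sum => i _; rewrite -!big_split /= big_mkcond; apply: ler_sum => j _.
  rewrite -val_eqE /= (P_sym j) (F_sym j).
  case: (ltngtP i j) => [lt|lt|<-]; case: (P _ _);
    rewrite /= ?mul0r ?mul1r ?add0r ?addr0 ?ler_norm //.
  exact: le_trans (ler_norm _) (F_diag _).
apply: le_trans tri _; rewrite !big_split /=.
have -> : \sum_(i < K) \sum_(j < K) (i == j)%:R * B = K%:R * B.
  rewrite (eq_bigr (fun=> B)) => [|i _].
    by rewrite sumr_const card_ord -[_ *+ _]mulr_natl.
  rewrite (bigD1 i) //= eqxx mul1r big1 ?addr0 // => j.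
  by rewrite eq_sym => /negbTE ->; rewrite mul0r.
rewrite lerD2l.
have -> : \sum_(i < K) \sum_(j < K)
   (if (j < i)%N && P j i then `|F j i| else 0) =
   \sum_(i < K) \sum_(j < K | (i < j)%N && P i j) `|F i j|.
  by rewrite exchange_big /=; apply: eq_bigr => i _; rewrite -big_mkcond.
rewrite mulr2n mulrDl mul1r lerD2r le_eqVlt; apply/orP; left; apply/eqP.
by apply: eq_bigr => i _; rewrite -big_mkcond.
Qed.

(* Only shifts of equal colour are correlated, at the cost of a factor equal
   to the number of colours. *)
Lemma van_der_corput (a : nat -> R) c K P (col : nat -> nat) N :
  (forall n, `|a n| <= 1) -> (0 < K)%N ->
  (forall i, (i < K)%N -> (col i < P)%N) ->
  (\sum_(n < N) a n) ^+ 2 <= 2 * (c%:R * K%:R) ^+ 2 + 2 * N%:R * P%:R *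
   (N%:R / K%:R + 2 / K%:R ^+ 2 *
     \sum_(i < K) \sum_(j < K | (i < j)%N && (col i == col j))
       `|\sum_(n < N) a (n + c * i)%N * a (n + c * j)%N|).
Proof.
move=> a_le K_gt0 col_lt; set S := \sum_(n < N) a n; set C := \sum_(i < K) _.
pose T := \sum_(i < K) \sum_(n < N) a (n + c * i)%N.
have K0 : 0 < K%:R :> R by rewrite ltr0n.
have ST : `|K%:R * S - T| <= 2 * c%:R * K%:R ^+ 2 / 2.
  have -> : K%:R * S - T = \sum_(i < K) (S - \sum_(n < N) a (n + c * i)%N).
    by rewrite sumrB sumr_const card_ord mulr_natl.
  apply: le_trans (ler_norm_sum _ _ _) _.
  apply: (@le_trans _ _ (\sum_(i < K) 2 * (c%:R * i%:R))).
    by apply: ler_sum => i _; rewrite -natrM; apply: sum_shift_le.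
  rewrite -!mulr_sumr -!mulrA ler_pM2l // ler_wpM2l //.
  have : (\sum_(i < K) i%:R : R) * 2 <= K%:R ^+ 2.
    rewrite -natr_sum -[2]/(2%:R) -natrM -natrX ler_nat.
    rewrite -(big_mkord predT (fun i => i)) /= bin2_sum bin2; nia.
  by rewrite mulrA ler_pdivlMr.
have T_le : T ^+ 2 <= N%:R * (P%:R * (K%:R * N%:R + 2 * C)).
  rewrite /T exchange_big /=; apply: le_trans (sum_sqr_le _) _.
  rewrite card_ord ler_wpM2l //.
  apply: (@le_trans _ _ (\sum_(n < N) P%:R * \sum_(i < K)
     \sum_(j < K | col i == col j) a (n + c * i)%N * a (n + c * j)%N)).
    apply: ler_sum => n _.
    exact: (@coloured_sqr_le K P col (fun i => a (n + c * i)%N)).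
  rewrite -mulr_sumr ler_wpM2l // exchange_big /=.
  rewrite (eq_bigr (fun i : 'I_K => \sum_(j < K | col i == col j)
     \sum_(n < N) a (n + c * i)%N * a (n + c * j)%N)); last first.
    by move=> i _; rewrite exchange_big.
  apply: (@sum_pairs_le K (fun i j => col i == col j)
    (fun i j => \sum_(n < N) a (n + c * i)%N * a (n + c * j)%N)).
  - move=> i; apply: le_trans (ler_norm_sum _ _ _) _.
    rewrite -[X in _ <= X%:R]card_ord -sum1_card natr_sum; apply: ler_sum => n _.
    rewrite normrM; apply: le_trans (ler_wpM2l _ (a_le _)) _ => //.
    by rewrite mulr1.
  - by move=> i j; apply: eq_bigr => n _; rewrite mulrC.
  - by move=> i j; rewrite eq_sym.
have S2 : (K%:R * S) ^+ 2 <= 2 * (c%:R * K%:R ^+ 2) ^+ 2 + 2 * T ^+ 2.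
  have h : (K%:R * S - T) ^+ 2 <= (c%:R * K%:R ^+ 2) ^+ 2.
    rewrite -real_normK ?num_real // lerXn2r ?nnegrE ?mulr_ge0 //.
    apply: le_trans ST _; lra.
  have := sqr_ge0 (K%:R * S - 2 * T); move: h; set u := K%:R * S.
  set v := (_ * _) ^+ 2; nra.
rewrite -(ler_pM2l (exprn_gt0 2 K0)) -exprMn; apply: le_trans S2 _.
apply: (@le_trans _ _ (2 * (c%:R * K%:R ^+ 2) ^+ 2 +
  2 * (N%:R * (P%:R * (K%:R * N%:R + 2 * C))))).
  by rewrite lerD2l ler_pM2l.
rewrite le_eqVlt; apply/orP; left; apply/eqP; field.
by rewrite gt_eqF.
Qed.

Lemma equidistribution M N d c (F : nat -> R) : (0 < M)%N -> coprime d M ->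
  (M %| N)%N ->
  \sum_(n < N) F ((n * d + c) %% M)%N = N%:R / M%:R * \sum_(m < M) F m.
Proof.
move=> M_gt0 co_dM /dvdnP[Q ->].
have modlt m : (m %% M < M)%N by rewrite ltn_mod.
have base : \sum_(m < M) F ((m * d + c) %% M)%N = \sum_(m < M) F m.
  rewrite [RHS](reindex_inj (h := fun m : 'I_M => Ordinal (modlt (m * d + c)%N))) //.
  move=> x y /(congr1 val) /= /eqP; rewrite eqn_modDr => h; apply: val_inj.
  have {h} : (x == y %[mod M])%N.
    move: h; wlog le : x y / (x <= y)%N => [hw|].
      case/orP: (leq_total x y) => le h; first exact: hw.
      by rewrite eq_sym; apply: hw => //; rewrite eq_sym.
    by rewrite eq_sym eqn_mod_dvd ?leq_mul2r ?le ?orbT // -mulnBl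
      Gauss_dvdl 1?coprime_sym // -eqn_mod_dvd // eq_sym.
  by rewrite !modn_small // => /eqP.
rewrite mulnC (sum_ord_split _ _ (fun n => F ((n * d + c) %% M)%N)) -base.
rewrite natrM [_ * Q%:R]mulrC mulfK ?pnatr_eq0 -?lt0n //.
rewrite mulr_sumr; apply: eq_bigr => x _.
rewrite (eq_bigr (fun=> F ((x * d + c) %% M)%N)) => [|y _].
  by rewrite sumr_const card_ord -[_ *+ _]mulr_natl.
by rewrite mulnDl -addnA -mulnA [(M * _)%N]mulnC modnMDl.
Qed.

Lemma sum_ltn_ord M A : \sum_(m < M) ((m < A)%N : nat)%:R <= A%:R :> R.
Proof.
rewrite -natr_sum ler_nat -(big_mkord predT (fun m => (m < A)%N : nat)).
have -> : (\sum_(0 <= m < M) (m < A) = minn A M)%N; last exact: geq_minl.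
elim: M => [|M IHM]; first by rewrite big_nil minn0.
by rewrite big_nat_recr //= IHM; case: ltnP; lia.
Qed.

Lemma sum_geq_ord M A : \sum_(m < M) ((M - A <= m)%N : nat)%:R <= A%:R :> R.
Proof.
rewrite -natr_sum ler_nat -(big_mkord predT (fun m => (M - A <= m)%N : nat)).
have h K : (\sum_(0 <= m < K) (M - A <= m) = K - (M - A))%N.
  elim: K => [|K IHK]; first by rewrite big_nil.
  by rewrite big_nat_recr //= IHK; case: leqP; lia.
rewrite h; lia.
Qed.

Lemma prod_diff_le (I : Type) (r : seq I) (p q : I -> R) :
  (forall i, `|p i| <= 1) -> (forall i, `|q i| <= 1) ->
  `|\prod_(i <- r) p i - \prod_(i <- r) q i| <= \sum_(i <- r) `|p i - q i|.
Proof.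
move=> p_le q_le; elim: r => [|i r IHr]; first by rewrite !big_nil subrr normr0.
rewrite !big_cons; set P := \prod_(i <- r) p i; set Q := \prod_(i <- r) q i.
have -> : p i * P - q i * Q = (p i - q i) * P + q i * (P - Q) by ring.
apply: le_trans (ler_normD _ _) _; rewrite !normrM; apply: lerD.
  by rewrite ler_piMr // normr_prod prodr_ile1 // => j _; rewrite normr_ge0 p_le.
by apply: le_trans IHr; rewrite ler_piMl.
Qed.
End VanDerCorput.

(** * Removing digits *)

Section Digits.
Variable R : realFieldType.

Definition word (cs : seq nat) d j n : R := \prod_(c <- cs) tau R ((n + c) * d + j).

Definition word_mod M (cs : seq nat) d j n : R :=
  \prod_(c <- cs) tau R (((n + c) * d + j) %% M).

Lemma prod_tau_norm (I : Type) (r : seq I) (u : I -> nat) :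
  `|\prod_(i <- r) tau R (u i)| = 1.
Proof. by rewrite normr_prod big1 // => i _; apply: tau_norm. Qed.

(** The digits from position [k] on give the same sign to every factor, and the number of factors is
    even. *)
Lemma word_modE k cs d j n q : ~~ odd (size cs) ->
  {in cs, forall c, ((n + c) * d + j) %/ 2 ^ k = q}%N ->
  word cs d j n = word_mod (2 ^ k) cs d j n.
Proof.
move=> even_cs hq; rewrite /word big_seq.
under eq_bigr => c c_in do rewrite (tau_divn _ k) hq //.
rewrite -big_seq big_split /= big_const_seq count_predT iter_mulr_1.
rewrite -(odd_double_half (size cs)) (negbTE even_cs) add0n -mul2n exprM expr2.
by rewrite tau_sqr expr1n mul1r.
Qed.

(** For [T = 1] the sum telescopes; a step of length [T] is [T] steps of length 1. This bounds the
    number of [n] for which [g] changes between [n] and [n + T]. *)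
Lemma sum_increment_le (g : nat -> nat) N T : {homo g : m n / (m <= n)%N} ->
  (\sum_(n < N) (g (n + T) - g n) <= T * (g (N + T) - g 0))%N.
Proof.
move=> g_mono; elim: T => [|T IHT].
  by rewrite big1 // => n _; rewrite addn0 subnn.
have g_le m n : (m <= n)%N -> (g m <= g n)%N by apply: g_mono.
rewrite (eq_bigr (fun n : 'I_N => (g (n + T) - g n) + (g (n + T).+1 - g (n + T)))%N);
  last first.
  move=> n _; rewrite addnS.
  have h1 := g_le n (n + T)%N (leq_addr _ _).
  have h2 := g_le _ _ (leqnSn (n + T)); lia.
rewrite big_split /=.
have -> : (\sum_(n < N) (g (n + T).+1 - g (n + T)) = g (N + T) - g T)%N.
  elim: N {IHT} => [|N IHN]; first by rewrite big_ord0 subnn.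
  rewrite big_ord_recr /= IHN addSn.
  have h1 := g_le T (N + T)%N (leq_addl _ _).
  have h2 := g_le _ _ (leqnSn (N + T)); lia.
have h1 := g_le 0%N T (leq0n _).
have h2 := g_le _ _ (leqnSn (N + T)); rewrite addnS mulSn.
have h3 : (T * (g (N + T) - g 0) <= T * (g (N + T).+1 - g 0))%N.
  by rewrite leq_mul2l leq_sub2r ?orbT.
rewrite [X in (X <= _)%N]addnC; apply: leq_add; first exact: leq_sub.
exact: leq_trans IHT h3.
Qed.

(** Unless a multiple of [2 ^ k] is passed between [n * d + j] and [(n + T) * d + j], all arguments
    of the word share their high digits. The exceptional [n] are counted by [sum_increment_le], and
    each costs at most 2. *)
Lemma drop_high_digits k cs d j N T : ~~ odd (size cs) ->
  {in cs, forall c, c <= T}%N ->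
  `|\sum_(n < N) word cs d j n - \sum_(n < N) word_mod (2 ^ k) cs d j n| <=
  2 * T%:R * ((N + T)%:R * d%:R / 2 ^+ k + 1).
Proof.
move=> even_cs cs_le; pose g n := ((n * d + j) %/ 2 ^ k)%N.
have g_mono : {homo g : m n / (m <= n)%N}.
  by move=> m n le_mn; rewrite leq_div2r // leq_add2r leq_mul2r le_mn orbT.
rewrite -sumrB; apply: le_trans (ler_norm_sum _ _ _) _.
apply: (@le_trans _ _ (\sum_(n < N) 2 * (g (n + T) - g n)%N%:R)).
  apply: ler_sum => n _.
  have [eq_g|neq_g] := eqVneq (g (n + T)%N) (g n).
    rewrite (@word_modE k cs d j n (g n)) ?subrr ?normr0 ?mulr_ge0 // => c c_in.
    apply/eqP; rewrite eqn_leq -{1}eq_g -/(g (n + c)%N) !g_mono ?leq_addr //.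
    by rewrite leq_add2l cs_le.
  apply: (@le_trans _ _ (2 * 1)).
    apply: le_trans (ler_normB _ _) _; rewrite !prod_tau_norm; lra.
  rewrite ler_pM2l // ler1n subn_gt0 ltn_neqAle eq_sym neq_g /=.
  by rewrite g_mono ?leq_addr.
rewrite -mulr_sumr -natr_sum -mulrA ler_pM2l //.
apply: (@le_trans _ _ (T * (g (N + T) - g 0))%N%:R).
  by rewrite ler_nat sum_increment_le.
rewrite natrM ler_wpM2l //.
apply: (@le_trans _ _ (((N + T) * d) %/ 2 ^ k + 1)%N%:R).
  rewrite ler_nat /g mul0n add0n leq_subLR.
  rewrite -ltnS ltn_divLR ?expn_gt0 //.
  have := divn_eq ((N + T) * d) (2 ^ k); have := divn_eq j (2 ^ k).
  have : (((N + T) * d) %% 2 ^ k < 2 ^ k)%N by rewrite ltn_mod expn_gt0.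
  have : (j %% 2 ^ k < 2 ^ k)%N by rewrite ltn_mod expn_gt0.
  set K := (2 ^ k)%N; set a := ((N + T) * d)%N; nia.
rewrite natrD lerD2r -natrM -natrX ler_pdivlMr ?ltr0n ?expn_gt0 //.
by rewrite -natrM ler_nat leq_trunc_div.
Qed.

(* That is, [e * d] lies in [[-2 ^ mu, 2 ^ mu)] modulo [2 ^ lam]. *)
Definition window mu lam d e :=
  ((e * d + 2 ^ mu) %% 2 ^ lam < 2 ^ mu.+1)%N.

Definition cell mu lam d k := ((k * d) %% 2 ^ lam %/ 2 ^ mu)%N.

Lemma cell_lt mu lam d k : (mu <= lam)%N ->
  (cell mu lam d k < 2 ^ (lam - mu))%N.
Proof.
move=> le_mu; rewrite /cell ltn_divLR ?expn_gt0 // -expnD subnK //.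
by rewrite ltn_mod expn_gt0.
Qed.

Lemma cell_window mu lam d k k' : (mu < lam)%N -> (k <= k')%N ->
  cell mu lam d k = cell mu lam d k' -> window mu lam d (k' - k).
Proof.
rewrite /cell /window => lt_mu le_k.
set a := (_ %% _)%N; set b := (k' * d %% _)%N => eq_div.
have M_gt0 : (0 < 2 ^ mu)%N by rewrite expn_gt0.
have le_pow : (2 ^ mu.+1 <= 2 ^ lam)%N by rewrite leq_exp2l.
have lt_ab : (a < b + 2 ^ mu)%N /\ (b < a + 2 ^ mu)%N.
  have := divn_eq a (2 ^ mu); have := divn_eq b (2 ^ mu); rewrite eq_div.
  have := ltn_pmod a M_gt0; have := ltn_pmod b M_gt0; lia.
have -> : (((k' - k) * d + 2 ^ mu) = b + 2 ^ mu - a %[mod 2 ^ lam])%N.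
  apply/eqP; rewrite -(eqn_modDr (k * d)).
  have -> : ((k' - k) * d + 2 ^ mu + k * d = k' * d + 2 ^ mu)%N.
    by rewrite addnAC -mulnDl subnK.
  rewrite -[eqbRHS]modnDmr -/a subnK; last by case: lt_ab => /ltnW.
  by rewrite -[eqbLHS]modnDml.
rewrite modn_small; first by move: lt_ab; rewrite expnS; lia.
apply: leq_trans le_pow; move: lt_ab; rewrite expnS; lia.
Qed.

(* Shifting by [e * d], which is at most [2 ^ mu] in absolute value modulo
   [2 ^ lam], changes the digits above [rho] only through a carry. *)
Lemma drop_window_digits mu rho lam d e u : (rho <= lam)%N ->
  window mu lam d e -> (2 ^ mu <= u %% 2 ^ rho)%N ->
  (u %% 2 ^ rho + 2 ^ mu < 2 ^ rho)%N ->
  tau R (u %% 2 ^ lam) * tau R ((u + e * d) %% 2 ^ lam) =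
  tau R (u %% 2 ^ rho) * tau R ((u + e * d) %% 2 ^ rho).
Proof.
move=> le_rho hw lo hi.
have [r def_lam] : exists r, lam = (rho + r)%N.
  by exists (lam - rho)%N; rewrite subnKC.
have dvd_rho : (2 ^ rho %| 2 ^ lam)%N by rewrite dvdn_exp2l.
suff h : ((u + e * d) %% 2 ^ lam %/ 2 ^ rho = u %% 2 ^ lam %/ 2 ^ rho)%N.
  rewrite (tau_divn _ rho (u %% _)) (tau_divn _ rho ((u + _) %% _)) h.
  rewrite !(modn_dvdm _ dvd_rho) mulrACA tau_sqr mul1r //.
set w := ((e * d + 2 ^ mu) %% 2 ^ lam)%N in hw *.
have w_lt : (w < 2 ^ mu.+1)%N := hw.
set a := (u %% 2 ^ lam)%N; set b := (u %% 2 ^ rho)%N in lo hi *.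
have eq_b : (a %% 2 ^ rho = b)%N by rewrite /a /b modn_dvdm.
have a_lt : (a < 2 ^ lam)%N by rewrite ltn_mod expn_gt0.
have eq_a := divn_eq a (2 ^ rho); rewrite eq_b in eq_a.
have q_lt : (a %/ 2 ^ rho < 2 ^ r)%N.
  by rewrite ltn_divLR ?expn_gt0 // mulnC -expnD -def_lam.
have b_lt : (b + w - 2 ^ mu < 2 ^ rho)%N.
  rewrite ltn_subLR; last by rewrite (leq_trans lo) ?leq_addr.
  move: w_lt hi; rewrite expnS; set x := (2 ^ mu)%N; set y := (2 ^ rho)%N; lia.
have -> : ((u + e * d) %% 2 ^ lam = a %/ 2 ^ rho * 2 ^ rho + (b + w - 2 ^ mu))%N.
  rewrite -[RHS](@modn_small _ (2 ^ lam)); last first.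
    rewrite def_lam expnD; apply: leq_trans (_ : (a %/ 2 ^ rho).+1 * 2 ^ rho <= _)%N.
      by rewrite mulSn addnC ltn_add2r.
    by rewrite mulnC leq_mul2l q_lt orbT.
  apply/eqP; rewrite -(eqn_modDr (2 ^ mu)).
  have -> : (a %/ 2 ^ rho * 2 ^ rho + (b + w - 2 ^ mu) + 2 ^ mu = a + w)%N.
    by rewrite -addnA subnK ?addnA -?eq_a // (leq_trans lo) ?leq_addr.
  by rewrite -addnA -[eqbLHS]modnDm.
by rewrite divnMDl ?expn_gt0 // (divn_small b_lt) addn0.
Qed.

(** For each [c], the identity of [drop_window_digits] can fail only when the argument is within
    [2 ^ mu] of either end of its interval of length [2 ^ rho]. By equidistribution this has density
    at most [2 * 2 ^ mu / 2 ^ rho], and each failure costs at most 2, whence the factor 4. *)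
Lemma window_corr_le mu rho lam cs d j e k N : (rho <= lam)%N -> odd d ->
  (2 ^ rho %| N)%N -> window mu lam d e ->
  `|\sum_(n < N) word_mod (2 ^ lam) cs d j (n + k) *
                 word_mod (2 ^ lam) cs d j (n + (k + e))| <=
  N%:R / (2 ^ rho)%:R * (corr_sum R (2 ^ rho) cs d (e * d) +
                      4 * (size cs)%:R * (2 ^ mu)%:R).
Proof.
move=> le_rho odd_d dvd_N hw; set M := (2 ^ rho)%N.
have M_gt0 : (0 < M)%N by rewrite expn_gt0.
have co_d : coprime d M by rewrite coprime_sym coprimeXl // coprime2n.
pose H m := \prod_(c <- cs)
  (tau R ((m + c * d) %% M) * tau R ((m + c * d + e * d) %% M)).
have sumH : \sum_(n < N) H ((n * d + (k * d + j)) %% M)%N =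
    N%:R / M%:R * \sum_(m < M) H m by apply: equidistribution.
pose bad m : R := ((m < 2 ^ mu)%N : nat)%:R + ((M - 2 ^ mu <= m)%N : nat)%:R.
have sum_bad c : \sum_(n < N) bad ((n * d + ((k + c) * d + j)) %% M)%N <=
    N%:R / M%:R * (2 * (2 ^ mu)%:R).
  rewrite (equidistribution _ bad) // ler_wpM2l ?divr_ge0 //.
  rewrite big_split /=; apply: le_trans (lerD (sum_ltn_ord _ _ _) (sum_geq_ord _ _ _)) _.
  by rewrite mulrDl mul1r.
rewrite mulrDr; apply: (@le_trans _ _ (`|\sum_(n < N) H ((n * d + (k * d + j)) %% M)%N| +
  `|\sum_(n < N) (word_mod (2 ^ lam) cs d j (n + k) *
                 word_mod (2 ^ lam) cs d j (n + (k + e)) -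
     H ((n * d + (k * d + j)) %% M)%N)|)).
  rewrite sumrB; set x := \sum_(n < N) H _; set y := \sum_(n < N) _.
  have -> : y = x + (y - x) by ring.
  by apply: le_trans (ler_normD _ _) _; rewrite [x + _ - _]addrAC subrr add0r.
apply: lerD.
  by rewrite sumH normrM ger0_norm ?divr_ge0.
apply: le_trans (ler_norm_sum _ _ _) _.
apply: (@le_trans _ _ (\sum_(n < N) \sum_(c <- cs)
   2 * bad ((n * d + ((k + c) * d + j)) %% M)%N)).
  apply: ler_sum => n _; rewrite /word_mod -big_split /= /H.
  apply: le_trans (prod_diff_le _ _ _) _.
  - by move=> c; rewrite normrM !tau_norm mulr1.
  - by move=> c; rewrite normrM !tau_norm mulr1.
  apply: ler_sum => c _; set u := ((n + k + c) * d + j)%N.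
  have -> : ((n + (k + e) + c) * d + j = u + e * d)%N by rewrite /u; lia.
  have -> : (((n * d + (k * d + j)) %% M + c * d) %% M = u %% M)%N.
    by rewrite modnDml /u; congr modn; lia.
  have -> : (((n * d + (k * d + j)) %% M + c * d + e * d) %% M = (u + e * d) %% M)%N.
    by rewrite -addnA modnDml /u; congr modn; lia.
  have -> : (n * d + ((k + c) * d + j) = u)%N by rewrite /u; lia.
  rewrite /bad; case: ltnP => [_|lo].
    apply: (@le_trans _ _ 2).
      by apply: le_trans (ler_normB _ _) _; rewrite !normrM !tau_norm; lra.
    by case: (_ <= _)%N => /=; lra.
  case: leqP => [_|hi].
    apply: (@le_trans _ _ 2).
      by apply: le_trans (ler_normB _ _) _; rewrite !normrM !tau_norm; lra.
    by rewrite /=; lra.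
  rewrite (@drop_window_digits mu rho) //; last by rewrite -/M; lia.
  by rewrite subrr normr0 /=; lra.
rewrite exchange_big /=.
apply: (@le_trans _ _ (\sum_(c <- cs) 2 * (N%:R / M%:R * (2 * (2 ^ mu)%:R)))).
  by apply: ler_sum => c _; rewrite -mulr_sumr ler_pM2l.
rewrite big_const_seq count_predT iter_addr_0 -[_ *+ _]mulr_natl.
rewrite le_eqVlt; apply/orP; left; apply/eqP; ring.
Qed.

Lemma corr_sum_mod M cs d h : corr_sum R M cs d h = corr_sum R M cs (d %% M) (h %% M).
Proof.
congr (`|_|); apply: eq_bigr => m _; apply: eq_bigr => c _.
congr (tau R _ * tau R _); first by rewrite -[in RHS]modnDmr modnMmr modnDmr.
by rewrite modnDmr -[in RHS]modnDml -[in RHS](modnDmr m) modnMmr modnDmr modnDml.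
Qed.

Lemma corr_sum_shift M cs d h t :
  corr_sum R M [seq (c + t)%N | c <- cs] d h = corr_sum R M cs d h.
Proof.
case: M => [|M]; first by rewrite /corr_sum !big_ord0.
pose H m := \prod_(c <- cs)
  (tau R ((m + c * d) %% M.+1) * tau R ((m + c * d + h) %% M.+1)).
have := @equidistribution R M.+1 M.+1 1 (t * d) H isT (coprime1n _) (dvdnn _).
rewrite divff ?pnatr_eq0 // mul1r => eq_H.
congr (`|_|); rewrite -[RHS]eq_H; apply: eq_bigr => m _.
rewrite big_map /H; apply: eq_bigr => c _; rewrite muln1 -!addnA !modnDml.
by congr (tau R (_ %% _) * tau R (_ %% _)); lia.
Qed.
End Digits.

(** * Averaging over the modulus *)

Section Counting.
Variable R : realFieldType.

Lemma sum_inj_le (I J : finType) (P : pred I) (phi : I -> J) (F : J -> R) :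
  (forall j, 0 <= F j) -> {in P &, injective phi} ->
  \sum_(i | P i) F (phi i) <= \sum_j F j.
Proof.
move=> F_ge0 inj_phi; pose A := [set i | P i].
have -> : \sum_(i | P i) F (phi i) = \sum_(i in A) F (phi i).
  by apply: eq_bigl => i; rewrite inE.
have inj_A : {in A &, injective phi}.
  by move=> x y; rewrite !inE => Px Py; apply: inj_phi.
rewrite -(big_imset _ inj_A) /= big_mkcond; apply: ler_sum => j _.
by case: ifP.
Qed.

Lemma mul_cancel_mod2 v lam e a b : ~~ (2 ^ v.+1 %| e)%N -> (v <= lam)%N ->
  (e * a = e * b %[mod 2 ^ lam])%N -> (a = b %[mod 2 ^ (lam - v)])%N.
Proof.
move=> v_ndvd le_v eq_mod.
wlog le_ab : a b eq_mod / (a <= b)%N => [hw|].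
  by case: (leqP a b) => [|/ltnW] le; [apply: hw | apply/esym/hw].
have e_gt0 : (0 < e)%N by case: e v_ndvd eq_mod => //; rewrite dvdn0.
have [le_log [e' co_e def_e]] : (logn 2 e <= v)%N /\
    exists2 e', coprime 2 e' & e = (e' * 2 ^ logn 2 e)%N.
  split; first by rewrite -ltnS ltnNge -pfactor_dvdn.
  by have [e' co_e def_e] := pfactor_coprime (isT : prime 2) e_gt0; exists e'.
apply/esym/eqP; rewrite eqn_mod_dvd //.
have : (2 ^ lam %| e * (b - a))%N.
  by rewrite mulnBr -eqn_mod_dvd ?leq_mul2l ?le_ab ?orbT //; apply/eqP/esym.
set l := logn 2 e in le_log def_e *.
have {1}-> : lam = (l + (lam - l))%N by rewrite subnKC // (leq_trans le_log).
rewrite def_e -mulnA mulnCA expnD dvdn_pmul2l ?expn_gt0 //.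
rewrite Gauss_dvdr ?coprimeXl // => h.
by apply: dvdn_trans h; rewrite dvdn_exp2l // leq_sub2l.
Qed.

Lemma eq_divn_modn m n d : (m %/ d = n %/ d -> m = n %[mod d] -> m = n)%N.
Proof. by move=> hd hm; rewrite (divn_eq m d) (divn_eq n d) hd hm. Qed.

(** With [v] the 2-adic valuation of [e], the residue of [e * d + 2 ^ mu] is a multiple of [2 ^ v]
    below [2 ^ mu.+1], which leaves [2 ^ (mu.+1 - v)] values. Each of them fixes [d] modulo
    [2 ^ (lam - v)], hence up to [2 ^ v] choices. *)
Lemma window_count mu lam e : (0 < e <= 2 ^ mu)%N -> (mu < lam)%N ->
  (#|[pred d : 'I_(2 ^ lam) | window mu lam d e]| <= 2 ^ mu.+1)%N.
Proof.
move=> /andP[e_gt0 e_le] lt_mu; set v := logn 2 e.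
have v_dvd : (2 ^ v %| e)%N by rewrite pfactor_dvdn.
have v_ndvd : ~~ (2 ^ v.+1 %| e)%N by rewrite pfactor_dvdn // ltnn.
have v_le : (v <= mu)%N.
  by rewrite -(@leq_exp2l 2) // (leq_trans _ e_le) // dvdn_leq.
have v_lam : (v <= lam)%N by rewrite (leq_trans v_le) // ltnW.
pose r d := ((e * d + 2 ^ mu) %% 2 ^ lam)%N.
have r_dvd d : (2 ^ v %| r d)%N.
  rewrite /r /dvdn modn_dvdm ?dvdn_exp2l // -/(dvdn _ _).
  by rewrite dvdn_add ?dvdn_mulr ?dvdn_exp2l.
have lt2 (d : 'I_(2 ^ lam)) : (d %/ 2 ^ (lam - v) < 2 ^ v)%N.
  by rewrite ltn_divLR ?expn_gt0 // -expnD subnKC.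
pose J := ('I_(2 ^ (mu.+1 - v)).-1.+1 * 'I_(2 ^ v))%type.
pose phi (d : 'I_(2 ^ lam)) : J := (inord (r d %/ 2 ^ v), Ordinal (lt2 d)).
have -> : (2 ^ mu.+1 = #|{: J}|)%N.
  rewrite card_prod !card_ord prednK ?expn_gt0 // -expnD subnK //.
  exact: leq_trans v_le _.
rewrite -(@card_in_image _ _ phi) ?max_card // => d1 d2 hd1 hd2 [].
move=> eq_r eq_q; apply: val_inj => /=; apply: eq_divn_modn eq_q _.
apply: (@mul_cancel_mod2 v _ e) => //; apply/eqP.
rewrite -(eqn_modDr (2 ^ mu)) -/(r _) -/(r _).
have lt_r d : window mu lam d e -> (r d %/ 2 ^ v < (2 ^ (mu.+1 - v)).-1.+1)%N.
  rewrite /window -/(r d) => hw; rewrite prednK ?expn_gt0 //.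
  by rewrite ltn_divLR ?expn_gt0 // -expnD subnK // (leq_trans v_le).
move: eq_r => /(congr1 val); rewrite /= !inordK ?lt_r // => eq_r.
apply/eqP; rewrite -(divnK (r_dvd d1)) -(divnK (r_dvd d2)) eq_r //.
Qed.

(* The map sending [(e, d)] to [d] and [e * d] modulo [2 ^ rho] and to the [w]
   leading digits of [d] is injective: [d] being odd, the first two determine
   [e]; as the window is shorter than [2 ^ rho], they determine [e * d] modulo
   [2 ^ lam], hence [d] up to its [w] leading digits. *)
Lemma window_pairs_le mu rho lam w X : (mu < rho <= lam)%N -> (w < lam)%N ->
  (X <= 2 ^ rho)%N ->
  let P := [pred p : 'I_X * 'I_(2 ^ lam) | [&& ~~ (2 ^ w %| p.1)%N, odd p.2
    & window mu lam p.2 p.1]] in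
  forall F : nat -> nat -> R, (forall d h, 0 <= F d h) ->
  \sum_(p | P p) F (p.2 %% 2 ^ rho)%N ((p.1 * p.2) %% 2 ^ rho)%N <=
  2 ^+ w * \sum_(d < 2 ^ rho) \sum_(h < 2 ^ rho) F d h.
Proof.
move=> /andP[lt_mu le_rho] lt_w le_X P F F_ge0.
have le_w := ltnW lt_w.
have modlt m : (m %% 2 ^ rho < 2 ^ rho)%N by rewrite ltn_mod expn_gt0.
have divlt (d : 'I_(2 ^ lam)) : (d %/ 2 ^ (lam - w) < 2 ^ w)%N.
  by rewrite ltn_divLR ?expn_gt0 // -expnD subnKC.
pose J := ('I_(2 ^ w) * ('I_(2 ^ rho) * 'I_(2 ^ rho)))%type.
pose phi (p : 'I_X * 'I_(2 ^ lam)) : J := (Ordinal (divlt p.2),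
  (Ordinal (modlt p.2), Ordinal (modlt (p.1 * p.2)%N))).
pose G (x : J) := F x.2.1 x.2.2.
have -> : 2 ^+ w * \sum_(d < 2 ^ rho) \sum_(h < 2 ^ rho) F d h = \sum_x G x.
  transitivity (\sum_(x < 2 ^ w) \sum_y G (x, y)).
    rewrite /G /= sumr_const card_ord -[RHS]mulr_natl natrX pair_big.
    by congr (_ * _); apply: eq_bigr => -[].
  by rewrite pair_big; apply: eq_bigr => -[].
apply: (@sum_inj_le _ _ P phi G) => [x|]; first exact: F_ge0.
move=> [e1 d1] [e2 d2] /= /and3P[/= w1 odd1 win1] /and3P[/= w2 odd2 win2].
case=> eq_q eq_d eq_ed.
have eq_e : e1 = e2.
  have co_d : coprime (2 ^ rho) d1 by rewrite coprimeXl // coprime2n.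
  have h : (d1 * e1 = d1 * e2 %[mod 2 ^ (rho + 0)])%N.
    by rewrite addn0 [(d1 * e1)%N]mulnC eq_ed -modnMmr -eq_d modnMmr mulnC.
  have {h} := @mul_cancel_mod2 0 rho d1 e1 e2.
  rewrite dvdn2 odd1 subn0 => /(_ isT isT).
  rewrite mulnC eq_ed -modnMmr -eq_d modnMmr [(e2 * _)%N]mulnC => /(_ erefl).
  by rewrite !modn_small ?(leq_trans (ltn_ord _)) // => /val_inj.
subst e2; congr pair; apply: val_inj => /=.
apply: eq_divn_modn eq_q _.
case: w {divlt phi G J P lt_w} le_w w1 w2 => [|w] lt_w w1 w2.
  by rewrite dvd1n in w1.
have h : (e1 * d1 = e1 * d2 %[mod 2 ^ lam])%N.
  apply/eqP; rewrite -(eqn_modDr (2 ^ mu)); apply/eqP.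
  have dvd_rho : (2 ^ rho %| 2 ^ lam)%N by rewrite dvdn_exp2l.
  have : ((e1 * d1 + 2 ^ mu) %% 2 ^ lam = (e1 * d2 + 2 ^ mu) %% 2 ^ lam %[mod 2 ^ rho])%N.
    by rewrite !modn_dvdm // -modnDml eq_ed modnDml.
  have le_pow : (2 ^ mu.+1 <= 2 ^ rho)%N by rewrite leq_exp2l.
  by rewrite !(modn_small (leq_trans _ le_pow)).
have := mul_cancel_mod2 w1 (ltnW lt_w) h.
have -> : (lam - w = (lam - w.+1).+1)%N by rewrite subnSK.
move=> h2; have := congr1 (modn^~ (2 ^ (lam - w.+1))%N) h2.
by rewrite !modn_dvdm ?dvdn_exp2l.
Qed.

Lemma dvd_count w X : (#|[pred e : 'I_X | (0 < e) && (2 ^ w %| e)]%N| <= X %/ 2 ^ w)%N.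
Proof.
have [X0|X_gt0] := posnP (X %/ 2 ^ w).
  rewrite ?X0 leqn0; apply/eqP/eq_card0 => e; rewrite !inE; apply/negbTE.
  apply/negP => /andP[e_gt0 dvd_e].
  have le_X := leq_trans (dvdn_leq e_gt0 dvd_e) (ltnW (ltn_ord e)).
  by move/eqP: X0; rewrite -leqn0 leqNgt divn_gt0 ?expn_gt0 ?le_X.
pose phi (e : 'I_X) : 'I_(X %/ 2 ^ w).-1.+1 := inord (e %/ 2 ^ w).-1.
rewrite -[X in (_ <= X)%N](prednK X_gt0) -[X in (_ <= X)%N]card_ord.
rewrite -(@card_in_image _ _ phi) ?max_card // => e1 e2.
rewrite !inE => /andP[e1_gt0 dvd1] /andP[e2_gt0 dvd2] /(congr1 val) /=.
have lt (e : 'I_X) : (0 < e)%N -> (2 ^ w %| e)%N ->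
    (0 < e %/ 2 ^ w)%N /\ ((e %/ 2 ^ w).-1 < (X %/ 2 ^ w).-1.+1)%N.
  move=> e_gt0 dvd_e; have g0 : (0 < e %/ 2 ^ w)%N.
    by rewrite divn_gt0 ?expn_gt0 // dvdn_leq.
  by split=> //; rewrite !prednK // leq_div2r // ltnW.
have [p1 l1] := lt _ e1_gt0 dvd1; have [p2 l2] := lt _ e2_gt0 dvd2.
rewrite !inordK // => eq_p; apply: val_inj.
rewrite /= -(divnK dvd1) -(divnK dvd2); congr (_ * _)%N.
by rewrite -(prednK p1) -(prednK p2) eq_p.
Qed.
End Counting.

(** * Both applications of van der Corput's inequality, for a single modulus *)

Section PointwiseBound.
Variable R : realFieldType.

Definition window_term mu rho cs d h : R :=
  (corr_sum R (2 ^ rho) cs d h + 4 * (size cs)%:R * (2 ^ mu)%:R) / (2 ^ rho)%:R.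

Lemma window_term_ge0 mu rho cs d h : 0 <= window_term mu rho cs d h.
Proof. by rewrite divr_ge0 // addr_ge0 ?corr_sum_ge0 // !mulr_ge0. Qed.

Definition window_sum mu rho lam X cs d : R :=
  \sum_(e < X | (0 < e)%N && window mu lam d e) window_term mu rho cs d (e * d).

Lemma window_sum_ge0 mu rho lam X cs d : 0 <= window_sum mu rho lam X cs d.
Proof. by apply: sumr_ge0 => e _; apply: window_term_ge0. Qed.

(** The shifts are coloured by their cell. For fixed [i], distinct [k] give distinct differences
    [e = k - i], all in the window, so the correlated pairs amount to at most [X] copies of
    [window_sum]. *)
Lemma word_mod_sqr_le mu rho lam X cs d j N : (mu < lam)%N -> (rho <= lam)%N ->
  (0 < X)%N -> odd d -> (2 ^ rho %| N)%N ->
  (\sum_(n < N) word_mod R (2 ^ lam) cs d j n) ^+ 2 <=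
  2 * X%:R ^+ 2 + 2 * N%:R ^+ 2 * (2 ^ (lam - mu))%:R / X%:R *
    (1 + 2 * window_sum mu rho lam X cs d).
Proof.
move=> lt_mu le_rho X_gt0 odd_d dvd_N.
have X0 : 0 < X%:R :> R by rewrite ltr0n.
apply: le_trans (@van_der_corput R (word_mod R (2 ^ lam) cs d j) 1 X
  (2 ^ (lam - mu)) (cell mu lam d) N _ X_gt0 _) _.
- by move=> n; rewrite prod_tau_norm.
- by move=> i _; apply: cell_lt; apply: ltnW.
set C := \sum_(i < X) _.
have C_le : C <= X%:R * (N%:R * window_sum mu rho lam X cs d).
  apply: (@le_trans _ _ (\sum_(i < X) N%:R * window_sum mu rho lam X cs d)).
    apply: ler_sum => i _; rewrite /window_sum mulr_sumr [X in _ <= X]big_mkcond /=.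
    pose F (e : 'I_X) := if (0 < e)%N && window mu lam d e
      then N%:R * window_term mu rho cs d (e * d) else 0.
    have lt_sub (k : 'I_X) : (k - i < X)%N.
      exact: leq_ltn_trans (leq_subr _ _) (ltn_ord k).
    apply: (@le_trans _ _ (\sum_(k < X | (i < k)%N &&
        (cell mu lam d i == cell mu lam d k)) F (Ordinal (lt_sub k)))).
      apply: ler_sum => k /andP[lt_ik /eqP eq_cell].
      have hw := cell_window lt_mu (ltnW lt_ik) eq_cell.
      rewrite /F /= subn_gt0 lt_ik hw /= !mul1n.
      have := @window_corr_le R mu rho lam cs d j (k - i) i N le_rho odd_d dvd_N hw.
      rewrite subnKC; last exact: ltnW.
      by rewrite [_ / _ * _]mulrAC -mulrA.
    apply: (@sum_inj_le _ _ _ _ (fun k => Ordinal (lt_sub k)) F).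
      move=> e; rewrite /F; case: ifP => // _.
      by rewrite mulr_ge0 // window_term_ge0.
    move=> k1 k2 /= /andP[lt1 _] /andP[lt2 _] /(congr1 val) /= h.
    by apply: val_inj => /=; move: lt1 lt2 h; lia.
  by rewrite sumr_const card_ord -[_ *+ X]mulr_natl.
rewrite mul1r lerD2l.
apply: (@le_trans _ _ (2 * N%:R * (2 ^ (lam - mu))%:R *
  (N%:R / X%:R + 2 / X%:R ^+ 2 * (X%:R * (N%:R * window_sum mu rho lam X cs d))))).
  rewrite ler_wpM2l ?mulr_ge0 // lerD2l.
  by rewrite ler_wpM2l ?divr_ge0 ?exprn_ge0.
rewrite le_eqVlt; apply/orP; left; apply/eqP; field.
by rewrite gt_eqF.
Qed.

(** Shifting by multiples of [L] keeps two copies of a set of letters below [L] disjoint, so no two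
    factors coincide. Having two copies also makes the number of factors even. *)
Definition shifted_pair L (ls : seq nat) i k :=
  [seq (l + L * i)%N | l <- ls] ++ [seq (l + L * k)%N | l <- ls].

Lemma word_shifted_pair L ls i k d j n :
  word R ls d j (n + L * i) * word R ls d j (n + L * k) =
  word R (shifted_pair L ls i k) d j n.
Proof.
rewrite /word /shifted_pair big_cat !big_map; congr (_ * _);
  by apply: eq_bigr => l _; rewrite addnAC addnA.
Qed.

Definition pair_sum K (F : nat -> nat -> R) : R :=
  \sum_(i < K) \sum_(k < K | (i < k)%N) F i k.

Lemma pair_sumE K F : pair_sum K F =
  \sum_(p : 'I_K * 'I_K) (if (p.1 < p.2)%N then F p.1 p.2 else 0).
Proof.
rewrite /pair_sum -(pair_bigA _ (fun i k : 'I_K => if (i < k)%N then F i k else 0)).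
by apply: eq_bigr => i _; rewrite big_mkcond.
Qed.

Lemma ler_pair_sum K F1 F2 :
  (forall i k, (i < k < K)%N -> F1 i k <= F2 i k) -> pair_sum K F1 <= pair_sum K F2.
Proof.
move=> h; apply: ler_sum => i _; apply: ler_sum => k lt_ik.
by apply: h; rewrite lt_ik /=.
Qed.

Lemma pair_sum_ge0 K F : (forall i k, 0 <= F i k) -> 0 <= pair_sum K F.
Proof. by move=> h; do 2!apply: sumr_ge0 => ? _. Qed.

Lemma pair_sumD K F1 F2 :
  pair_sum K (fun i k => F1 i k + F2 i k) = pair_sum K F1 + pair_sum K F2.
Proof.
by rewrite -big_split; apply: eq_bigr => i _; rewrite big_split.
Qed.

Lemma pair_sumMl K c F : pair_sum K (fun i k => c * F i k) = c * pair_sum K F.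
Proof. by rewrite mulr_sumr; apply: eq_bigr => i _; rewrite mulr_sumr. Qed.

Lemma pair_sum_const_le K c : 0 <= c -> pair_sum K (fun _ _ => c) <= K%:R ^+ 2 * c.
Proof.
move=> c_ge0; rewrite pair_sumE.
apply: (@le_trans _ _ (\sum_(p : 'I_K * 'I_K) c)).
  by apply: ler_sum => p _; case: ifP.
by rewrite sumr_const card_prod !card_ord -[_ *+ _]mulr_natl natrM expr2.
Qed.

Lemma pair_sum_sqr_le K F :
  pair_sum K F ^+ 2 <= K%:R ^+ 2 * pair_sum K (fun i k => F i k ^+ 2).
Proof.
rewrite !pair_sumE; apply: le_trans (sum_sqr_le _) _.
rewrite card_prod !card_ord natrM -expr2 ler_wpM2l ?exprn_ge0 //.
by apply: ler_sum => p _; case: ifP; rewrite ?expr0n.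
Qed.

Definition carry_error L K N d lam : R :=
  2 * (L * K)%:R * ((N + L * K)%:R * d%:R / 2 ^+ lam + 1).

Lemma carry_error_ge0 L K N d lam : 0 <= carry_error L K N d lam.
Proof.
by rewrite /carry_error !mulr_ge0 // addr_ge0 // divr_ge0 ?mulr_ge0 // exprn_ge0.
Qed.

Lemma word_sqr_le L ls K lam d j N : (0 < K)%N -> all (fun l => l < L)%N ls ->
  (\sum_(n < N) word R ls d j n) ^+ 2 <=
  2 * (L * K)%:R ^+ 2 + 2 * N%:R ^+ 2 / K%:R +
  4 * N%:R / K%:R ^+ 2 * pair_sum K (fun i k =>
    `|\sum_(n < N) word_mod R (2 ^ lam) (shifted_pair L ls i k) d j n| +
    carry_error L K N d lam).
Proof.
move=> K_gt0 /allP ls_lt.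
have K0 : 0 < K%:R :> R by rewrite ltr0n.
apply: le_trans (@van_der_corput R (word R ls d j) L K 1 (fun=> 0%N) N _ K_gt0 _) _.
- by move=> n; rewrite prod_tau_norm.
- by [].
rewrite -natrM mulr1 -addrA lerD2l.
set C := \sum_(i < K) _; set C' := pair_sum _ _.
have C_le : C <= C'.
  apply: ler_sum => i _; rewrite (eq_bigl (fun k : 'I_K => (i < k)%N)); last first.
    by move=> k; rewrite eqxx andbT.
  apply: ler_sum => k lt_ik.
  rewrite (eq_bigr (fun n : 'I_N => word R (shifted_pair L ls i k) d j n)); last first.
    by move=> n _; apply: word_shifted_pair.
  have := @drop_high_digits R lam (shifted_pair L ls i k) d j N (L * K).
  rewrite size_cat !size_map addnn odd_double => /(_ isT) h.
  rewrite -lerBlDl; apply: le_trans (lerB_dist _ _) (h _) => c.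
  rewrite mem_cat => /orP[] /mapP[l /ls_lt lt_l ->].
    by have := ltn_ord i; nia.
  by have := ltn_ord k; nia.
apply: (@le_trans _ _ (2 * N%:R * (N%:R / K%:R + 2 / K%:R ^+ 2 * C'))).
  rewrite ler_wpM2l ?mulr_ge0 // lerD2l.
  by rewrite ler_wpM2l ?divr_ge0 ?exprn_ge0.
rewrite le_eqVlt; apply/orP; left; apply/eqP; field.
by rewrite gt_eqF.
Qed.

(** The summands are, in order: shifting cost and diagonal of the first inequality, the removal of
    the high digits, shifting cost and diagonal of the second inequality, and the remaining
    correlations. None of them involves [j]. *)
Definition fourth_power_bound L ls K X N mu rho lam d : R :=
  2 * (2 * ((L * K)%:R / N%:R) ^+ 2 + 2 / K%:R) ^+ 2 +
  64 * (carry_error L K N d lam / N%:R) ^+ 2 +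
  128 * ((X%:R / N%:R) ^+ 2 + (2 ^ (lam - mu))%:R / X%:R) +
  256 * (2 ^ (lam - mu))%:R / X%:R / K%:R ^+ 2 *
    pair_sum K (fun i k => window_sum mu rho lam X (shifted_pair L ls i k) d).

Lemma word_fourth_power_le L ls K X N mu rho lam d j : (0 < K)%N -> (0 < X)%N ->
  (0 < N)%N -> (mu < lam)%N -> (rho <= lam)%N -> odd d -> (2 ^ rho %| N)%N ->
  all (fun l => l < L)%N ls ->
  (\sum_(n < N) word R ls d j n) ^+ 4 <=
  N%:R ^+ 4 * fourth_power_bound L ls K X N mu rho lam d.
Proof.
move=> K_gt0 X_gt0 N_gt0 lt_mu le_rho odd_d dvd_N ls_lt.
have N0 : 0 < N%:R :> R by rewrite ltr0n.
have K0 : 0 < K%:R :> R by rewrite ltr0n.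
have X0 : 0 < X%:R :> R by rewrite ltr0n.
set S := \sum_(n < N) _; pose s := S / N%:R.
have -> : S = N%:R * s by rewrite mulrC divfK // gt_eqF.
rewrite exprMn ler_pM2l ?exprn_gt0 //.
pose D i k := \sum_(n < N) word_mod R (2 ^ lam) (shifted_pair L ls i k) d j n.
pose beta := carry_error L K N d lam.
pose T := pair_sum K (fun i k => `|D i k| + beta).
pose W := pair_sum K (fun i k => window_sum mu rho lam X (shifted_pair L ls i k) d).
pose P : R := (2 ^ (lam - mu))%:R.
pose x : R := 2 * ((L * K)%:R / N%:R) ^+ 2 + 2 / K%:R.
pose y : R := 4 / K%:R ^+ 2 * (T / N%:R).
have s2_le : s ^+ 2 <= x + y.
  have := @word_sqr_le L ls K lam d j N K_gt0 ls_lt.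
  rewrite -/S -/T => h; rewrite /s expr_div_n ler_pdivrMr ?exprn_gt0 //.
  apply: le_trans h _; rewrite le_eqVlt; apply/orP; left; apply/eqP.
  by rewrite /x /y; field; rewrite !gt_eqF.
have T_le : T ^+ 2 <= K%:R ^+ 2 * (2 * (K%:R ^+ 2 * beta ^+ 2) + 2 *
    (K%:R ^+ 2 * (2 * X%:R ^+ 2 + 2 * N%:R ^+ 2 * P / X%:R) +
     4 * N%:R ^+ 2 * P / X%:R * W)).
  apply: le_trans (pair_sum_sqr_le _ _) _; rewrite ler_wpM2l ?exprn_ge0 //.
  apply: (@le_trans _ _ (pair_sum K (fun i k => 2 * beta ^+ 2 + 2 *
     ((2 * X%:R ^+ 2 + 2 * N%:R ^+ 2 * P / X%:R) +
      4 * N%:R ^+ 2 * P / X%:R * window_sum mu rho lam X (shifted_pair L ls i k) d)))).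
    apply: ler_pair_sum => i k _.
    apply: (@le_trans _ _ (2 * beta ^+ 2 + 2 * D i k ^+ 2)).
      have := sqr_ge0 (`|D i k| - beta); have := real_normK (num_real (D i k)).
      by set u := `|_|; nra.
    rewrite lerD2l ler_pM2l //.
    apply: le_trans (word_mod_sqr_le _ _ lt_mu le_rho X_gt0 odd_d dvd_N) _.
    rewrite -/P le_eqVlt; apply/orP; left; apply/eqP; field.
    by rewrite gt_eqF.
  rewrite pair_sumD; apply: lerD.
    by rewrite [X in _ <= X]mulrCA pair_sum_const_le // mulr_ge0 // sqr_ge0.
  rewrite pair_sumMl ler_pM2l // pair_sumD pair_sumMl -/W lerD2r.
  by rewrite pair_sum_const_le // addr_ge0 ?divr_ge0 ?mulr_ge0 ?exprn_ge0.
have -> : s ^+ 4 = (s ^+ 2) ^+ 2 by rewrite -exprM.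
apply: (@le_trans _ _ (2 * x ^+ 2 + 2 * y ^+ 2)).
  apply: (@le_trans _ _ ((x + y) ^+ 2)).
    by rewrite lerXn2r ?nnegrE ?sqr_ge0 // (le_trans (sqr_ge0 _) s2_le).
  by have := sqr_ge0 (x - y); nra.
rewrite /fourth_power_bound -/x -/P -/W -/beta -!addrA lerD2l.
have -> : 2 * y ^+ 2 = 32 / (K%:R ^+ 4 * N%:R ^+ 2) * T ^+ 2.
  by rewrite /y; field; rewrite !gt_eqF.
apply: le_trans (ler_wpM2l _ T_le) _.
  by rewrite divr_ge0 ?mulr_ge0 ?exprn_ge0.
rewrite le_eqVlt; apply/orP; left; apply/eqP; field.
by rewrite !gt_eqF.
Qed.
End PointwiseBound.

(** * Summation over odd moduli *)

Section AverageOverModuli.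
Variable R : realFieldType.

Lemma corr_sum_le M cs d h : corr_sum R M cs d h <= M%:R.
Proof.
apply: le_trans (ler_norm_sum _ _ _) _.
rewrite -[X in _ <= X%:R]card_ord -sum1_card natr_sum; apply: ler_sum => m _.
rewrite normr_prod big1 // => c _; by rewrite normrM !tau_norm mulr1.
Qed.

Lemma window_card_le (lam mu e : nat) (c : R) : (0 < e <= 2 ^ mu)%N -> (mu < lam)%N ->
  0 <= c ->
  \sum_(d < 2 ^ lam | odd d && window mu lam d e) c <= 2 * (2 ^ mu)%:R * c.
Proof.
move=> he lt_mu c_ge0.
apply: (@le_trans _ _ (\sum_(d < 2 ^ lam | window mu lam d e) c)).
  rewrite big_mkcond [X in _ <= X]big_mkcond; apply: ler_sum => d _.
  by case: (odd d) => //=; case: ifP.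
rewrite sumr_const -[_ *+ _]mulr_natl ler_wpM2r // -natrM ler_nat -expnS.
exact: window_count.
Qed.

(** The first term collects the residues near the ends of the intervals of length [2 ^ rho]. In the
    second, the rare [e] divisible by [2 ^ w] are estimated trivially. All other [e] are nearly odd,
    and [window_pairs_le] spreads the pairs over the full square. *)
Lemma window_sum_total mu rho lam w X cs : (mu < rho)%N -> (rho <= lam)%N ->
  (w < lam)%N -> (X <= 2 ^ mu)%N ->
  \sum_(d < 2 ^ lam | odd d) window_sum R mu rho lam X cs d <=
  X%:R * (2 * (2 ^ mu)%:R) * (4 * (size cs)%:R * (2 ^ mu)%:R / (2 ^ rho)%:R) +
  X%:R / 2 ^+ w * (2 * (2 ^ mu)%:R) +
  2 ^+ w * (\sum_(d < 2 ^ rho) \sum_(h < 2 ^ rho) corr_sum R (2 ^ rho) cs d h)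
   / (2 ^ rho)%:R.
Proof.
move=> lt_mr le_rl lt_w le_X.
have lt_mu : (mu < lam)%N by apply: leq_trans le_rl.
set c := _ / (2 ^ rho)%:R.
have c_ge0 : 0 <= c by rewrite divr_ge0 ?mulr_ge0.
pose F d h := corr_sum R (2 ^ rho) cs d h / (2 ^ rho)%:R.
have F_ge0 d h : 0 <= F d h by rewrite divr_ge0 ?corr_sum_ge0.
have M0 : 0 < (2 ^ rho)%:R :> R by rewrite ltr0n expn_gt0.
have F_le1 d h : F d h <= 1 by rewrite ler_pdivrMr // mul1r corr_sum_le.
have FE d h : F d h = F (d %% 2 ^ rho)%N (h %% 2 ^ rho)%N.
  by rewrite /F corr_sum_mod.
have e_le (e : 'I_X) : (0 < e)%N -> (0 < e <= 2 ^ mu)%N.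
  by move=> ->; rewrite (leq_trans _ le_X) // ltnW.
have -> : \sum_(d < 2 ^ lam | odd d) window_sum R mu rho lam X cs d =
    \sum_(e < X | (0 < e)%N) \sum_(d < 2 ^ lam | odd d && window mu lam d e) c +
    \sum_(e < X | (0 < e)%N) \sum_(d < 2 ^ lam | odd d && window mu lam d e)
      F d (e * d)%N.
  rewrite -big_split /=.
  rewrite (exchange_big_dep (fun e : 'I_X => (0 < e)%N)) /=.
    apply: eq_bigr => e e_gt0; rewrite -big_split /=.
    apply: eq_big => [d|d _]; first by rewrite e_gt0.
    by rewrite /window_term mulrDl addrC.
  by move=> d e _ /andP[].
rewrite -addrA; apply: lerD.
  apply: (@le_trans _ _ (\sum_(e < X) 2 * (2 ^ mu)%:R * c)).
    rewrite big_mkcond; apply: ler_sum => e _; case: ifP => [e_gt0|_].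
      by apply: window_card_le => //; apply: e_le.
    by rewrite mulr_ge0 // mulr_ge0.
  by rewrite sumr_const card_ord -[_ *+ X]mulr_natl mulrA.
rewrite (bigID (fun e : 'I_X => (2 ^ w %| e)%N)) /=; apply: lerD.
  apply: (@le_trans _ _ (\sum_(e < X | (0 < e)%N && (2 ^ w %| e)%N) 2 * (2 ^ mu)%:R)).
    apply: ler_sum => e /andP[e_gt0 _].
    rewrite -[X in _ <= X]mulr1; apply: le_trans (window_card_le _ lt_mu ler01).
      by apply: ler_sum.
    exact: e_le.
  rewrite sumr_const -[_ *+ _]mulr_natl ler_wpM2r ?mulr_ge0 //.
  apply: (@le_trans _ _ (X %/ 2 ^ w)%N%:R); first by rewrite ler_nat dvd_count.
  rewrite ler_pdivlMr ?exprn_gt0 // -natrX -natrM ler_nat.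
  exact: leq_trunc_div.
rewrite pair_big_dep /=.
have hmr : (mu < rho <= lam)%N by rewrite lt_mr.
have hX : (X <= 2 ^ rho)%N by apply: leq_trans le_X _; rewrite leq_exp2l // ltnW.
apply: le_trans (le_trans _ (window_pairs_le hmr lt_w hX F_ge0)) _.
  rewrite [X in X <= _]big_mkcond [X in _ <= X]big_mkcond /=.
  apply: ler_sum => -[e d] _ /=; case: (0 < e)%N => /=.
    by rewrite -FE.
  by case: ifP => // _; rewrite -FE.
rewrite -mulrA ler_wpM2l ?exprn_ge0 // mulr_suml.
by apply: ler_sum => d _; rewrite mulr_suml.
Qed.

Lemma pow_natr n t : (2 ^ (n * t))%:R = (2 ^+ t) ^+ n :> R.
Proof. by rewrite natrX mulnC exprM. Qed.

Lemma ler_sum_widen m n (P : pred nat) (F : nat -> R) : (m <= n)%N ->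
  (forall i, 0 <= F i) -> \sum_(i < m | P i) F i <= \sum_(i < n | P i) F i.
Proof.
move=> le_mn F_ge0; rewrite -!(big_mkord P F) [X in _ <= X](big_cat_nat (n := m)) //=.
by rewrite lerDl sumr_ge0.
Qed.

Lemma fourth_power_bound_ge0 L ls K X N mu rho lam d :
  0 <= fourth_power_bound R L ls K X N mu rho lam d.
Proof.
apply: addr_ge0; first (apply: addr_ge0; first apply: addr_ge0).
- by apply: mulr_ge0 (ler0n _ _) (sqr_ge0 _).
- by apply: mulr_ge0 (ler0n _ _) (sqr_ge0 _).
- apply: mulr_ge0 (ler0n _ _) (addr_ge0 (sqr_ge0 _) _).
  exact: divr_ge0 (ler0n _ _) (ler0n _ _).
- apply: mulr_ge0; last by apply: pair_sum_ge0 => i k; apply: window_sum_ge0.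
  apply: divr_ge0 (exprn_ge0 _ (ler0n _ _)); apply: divr_ge0 (ler0n _ _).
  exact: mulr_ge0 (ler0n _ _) (ler0n _ _).
Qed.

(* The exponents are such that every error term is smaller than the main term
   by at least a factor [2 ^ t]. *)
Lemma fourth_power_total L ls q t (kappa : R) : (0 < L)%N -> (5 <= q)%N -> (0 < t)%N ->
  0 <= kappa ->
  (forall i k, (i < k < 2 ^ t)%N ->
    (\sum_(d < 2 ^ ((q + 8) * t)) \sum_(h < 2 ^ ((q + 8) * t))
       corr_sum R (2 ^ ((q + 8) * t)) (shifted_pair L ls i k) d h)
    / (2 ^ ((q + 8) * t))%:R ^+ 3 <= kappa / (2 ^+ t) ^+ 20) ->
  \sum_(d < 2 ^ (2 * q * t) | odd d) fourth_power_bound R L ls (2 ^ t) (2 ^ (q * t))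
     (2 ^ ((q + 9) * t)) ((q + 4) * t) ((q + 8) * t) ((2 * q + 3) * t) d <=
  (8 * (L%:R ^+ 2 + 1) ^+ 2 + 256 * (L%:R * (L%:R + 2)) ^+ 2 + 256 +
    256 * (16 * (size ls)%:R + 2 + kappa)) * (2 ^ (2 * q * t))%:R / 2 ^+ t.
Proof.
move=> L_gt0 q_ge t_gt0 kappa_ge0 hkappa.
set b : R := 2 ^+ t in hkappa *; have b_ge1 : 1 <= b by rewrite exprn_ege1 // ler1n.
have b_gt0 : 0 < b by apply: lt_le_trans b_ge1.
have b_neq0 : b != 0 by rewrite gt_eqF.
have powE n : (2 ^ (n * t))%:R = b ^+ n :> R by apply: pow_natr.
have bK : (2 ^ t)%:R = b :> R by rewrite natrX.
clearbody b.
have pow_le m n : (m <= n)%N -> b ^+ m <= b ^+ n by move=> h; rewrite ler_weXn2l.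
have inv_le n : (0 < n)%N -> b ^- n <= b^-1.
  by move=> n_gt0; rewrite lef_pV2 ?posrE ?exprn_gt0 // -[X in X <= _]expr1 pow_le.
pose W d := pair_sum (2 ^ t) (fun i k =>
  window_sum R ((q + 4) * t) ((q + 8) * t) ((2 * q + 3) * t) (2 ^ (q * t))
    (shifted_pair L ls i k) d).
pose e1 : R := 8 * (L%:R ^+ 2 + 1) ^+ 2 + 256 * (L%:R * (L%:R + 2)) ^+ 2 + 256.
have lamE : ((2 * q + 3) * t - (q + 4) * t = (q - 1) * t)%N.
  by rewrite -mulnBl; congr muln; lia.
(* The cells are fewer than the shifts by exactly one factor [b]: this ratio is the diagonal term of
   the second inequality. *)
have ratio : (2 ^ ((2 * q + 3) * t - (q + 4) * t))%:R / (2 ^ (q * t))%:R = b^-1 :> R.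
  rewrite lamE !powE -[in X in _ / X](@subnK 1 q); last by lia.
  by rewrite exprD expr1 invfM mulrA divff ?mul1r // expf_neq0.
have pointwise (d : 'I_(2 ^ (2 * q * t))) :
   fourth_power_bound R L ls (2 ^ t) (2 ^ (q * t))
     (2 ^ ((q + 9) * t)) ((q + 4) * t) ((q + 8) * t) ((2 * q + 3) * t) d <=
   e1 / b + 256 / b / b ^+ 2 * W d.
  rewrite /fourth_power_bound -/(W d) bK -[256 * _ / _]mulrA ratio.
  apply: lerD; last by [].
  rewrite /e1 [X in _ <= X]mulrDl [X in _ <= X + _]mulrDl; apply: lerD; first apply: lerD.
  - have h1 : (L * 2 ^ t)%:R / (2 ^ ((q + 9) * t))%:R = L%:R / b ^+ (q + 8) :> R.
      rewrite natrM bK powE addnS exprS invfM -mulrA; congr (_ * _).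
      by rewrite mulrA divff ?mul1r.
    rewrite h1; have h2 : (L%:R / b ^+ (q + 8)) ^+ 2 <= L%:R ^+ 2 / b :> R.
      rewrite expr_div_n ler_wpM2l ?exprn_ge0 // -exprM inv_le //; lia.
    have h3 : 0 <= 2 * (L%:R / b ^+ (q + 8)) ^+ 2 + 2 / b :> R.
      apply: addr_ge0; first by rewrite mulr_ge0 // sqr_ge0.
      by rewrite divr_ge0 // ltW.
    apply: (@le_trans _ _ (2 * (2 * (L%:R ^+ 2 + 1) / b) ^+ 2)).
      rewrite ler_pM2l // lerXn2r ?nnegrE //.
        by rewrite divr_ge0 ?mulr_ge0 ?addr_ge0 ?exprn_ge0 // ltW.
      by move: h2; set u := (_ / _) ^+ 2; set v := b^-1; set l := L%:R ^+ 2; lra.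
    have -> : 2 * (2 * (L%:R ^+ 2 + 1) / b) ^+ 2 = 8 * (L%:R ^+ 2 + 1) ^+ 2 * b ^- 2 :> R.
      by field.
    apply: ler_wpM2l; last exact: inv_le.
    exact: mulr_ge0 (ler0n _ _) (sqr_ge0 _).
  - have h1 : carry_error R L (2 ^ t) (2 ^ ((q + 9) * t)) d ((2 * q + 3) * t)
        / (2 ^ ((q + 9) * t))%:R <= 2 * (L%:R * (L%:R + 2)) * b ^- 2 :> R.
      rewrite ler_pdivrMr ?powE ?exprn_gt0 // /carry_error !natrD !natrM bK powE.
      rewrite -natrX powE.
      (* Here [lam] exceeds [2 * q * t] by [3 * t]: the first shifts cost one factor [b], and
         [b ^- 2] is left. *)
      have d_le : (d : nat)%:R / b ^+ (2 * q + 3) <= b ^- 3 :> R.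
        rewrite ler_pdivrMr ?exprn_gt0 // addnC exprD mulrA mulVf ?expf_neq0 //.
        by rewrite mul1r -powE ler_nat ltnW.
      set N := b ^+ (q + 9).
      have N_ge : b ^+ 3 <= N by apply: pow_le; lia.
      have b_le : b <= N by rewrite -[X in X <= _]expr1 pow_le //; lia.
      have N1 : 1 <= N * b ^- 3 by rewrite ler_pdivlMr ?exprn_gt0 // mul1r.
      have L0 : 0 <= L%:R :> R by [].
      apply: (@le_trans _ _ (2 * (L%:R * b) * ((N + L%:R * N) * b ^- 3 + N * b ^- 3))).
        rewrite ler_wpM2l //; first by rewrite mulr_ge0 // mulr_ge0 // ltW.
        apply: lerD => //; rewrite -mulrA; apply: ler_pM => //.
        - by rewrite addr_ge0 ?mulr_ge0 ?exprn_ge0 // ltW.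
        - by rewrite divr_ge0 // exprn_ge0 // ltW.
        - by rewrite lerD2l ler_wpM2l.
      rewrite le_eqVlt; apply/orP; left; apply/eqP; field.
      by rewrite b_neq0.
    have h2 : 0 <= carry_error R L (2 ^ t) (2 ^ ((q + 9) * t)) d ((2 * q + 3) * t)
        / (2 ^ ((q + 9) * t))%:R by rewrite divr_ge0 ?carry_error_ge0.
    apply: (@le_trans _ _ (64 * (2 * (L%:R * (L%:R + 2)) * b ^- 2) ^+ 2)).
      rewrite ler_pM2l // lerXn2r ?nnegrE //.
      exact: le_trans h1.
    have -> : 64 * (2 * (L%:R * (L%:R + 2)) * b ^- 2) ^+ 2 =
       256 * (L%:R * (L%:R + 2)) ^+ 2 * b ^- 4 :> R by field.
    apply: ler_wpM2l; last exact: inv_le.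
    exact: mulr_ge0 (ler0n _ _) (sqr_ge0 _).
  - have h1 : ((2 ^ (q * t))%:R / (2 ^ ((q + 9) * t))%:R) ^+ 2 <= b^-1 :> R.
      rewrite !powE exprD invfM mulrA divff ?expf_neq0 // mul1r.
      by rewrite exprVn -exprM inv_le.
    move: h1; set u := (_ / _) ^+ 2; set v := b^-1; lra.
(* The three terms of [window_sum_total], with [w = 4 * t], are all of order [b ^+ (2 * q)]; for the
   last one this is what the exponent 20 in the hypothesis is made for. In the end the [b ^+ 2]
   pairs consume the factor [b ^- 2], and a saving of [b^-1] remains. *)
have total i k : (i < k < 2 ^ t)%N ->
  \sum_(d < 2 ^ (2 * q * t) | odd d) window_sum R ((q + 4) * t) ((q + 8) * t)
     ((2 * q + 3) * t) (2 ^ (q * t)) (shifted_pair L ls i k) d <=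
  (16 * (size ls)%:R + 2 + kappa) * b ^+ (2 * q).
  move=> /hkappa; rewrite powE; set Sigma := \sum_(d < 2 ^ ((q + 8) * t)) _ => hS.
  have Sigma_le : Sigma <= kappa * b ^+ (3 * q + 4).
    move: hS; rewrite ler_pdivrMr ?exprn_gt0 // -exprM.
    suff -> : kappa / b ^+ 20 * b ^+ ((q + 8) * 3) = kappa * b ^+ (3 * q + 4) by [].
    have -> : ((q + 8) * 3 = 20 + (3 * q + 4))%N by lia.
    by rewrite exprD mulrA divfK // expf_neq0.
  (* By positivity, the moduli may be extended to a full period modulo [2 ^ lam]. *)
  apply: le_trans (ler_sum_widen odd _ _) _; last first.
  - apply: le_trans (@window_sum_total ((q + 4) * t) ((q + 8) * t) ((2 * q + 3) * t)
      (4 * t) (2 ^ (q * t)) (shifted_pair L ls i k) _ _ _ _) _; try nia.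
      by rewrite leq_exp2l // leq_mul2r; lia.
    rewrite -/Sigma -natrX !powE size_cat !size_map.
    have p1 : b ^+ q * (2 * b ^+ (q + 4)) * (4 * (size ls + size ls)%:R * b ^+ (q + 4) /
        b ^+ (q + 8)) = 16 * (size ls)%:R * b ^+ (2 * q) :> R.
      rewrite natrD mul2n -addnn !exprD.
      by field; rewrite b_neq0 expf_neq0.
    have p2 : b ^+ q / b ^+ 4 * (2 * b ^+ (q + 4)) = 2 * b ^+ (2 * q).
      by rewrite mul2n -addnn !exprD; field.
    have p3 : b ^+ 4 * Sigma / b ^+ (q + 8) <= kappa * b ^+ (2 * q).
      rewrite ler_pdivrMr ?exprn_gt0 // -[X in _ <= X]mulrA -exprD.
      have -> : (2 * q + (q + 8) = 4 + (3 * q + 4))%N by lia.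
      by rewrite exprD mulrCA ler_wpM2l ?exprn_ge0 // ltW.
    by rewrite p1 p2 !mulrDl !lerD2l.
  - by move=> d; apply: window_sum_ge0.
  - by rewrite leq_exp2l // leq_mul2r; lia.
apply: (@le_trans _ _ (\sum_(d < 2 ^ (2 * q * t) | odd d)
    (e1 / b + 256 / b / b ^+ 2 * W d))).
  by apply: ler_sum => d _; apply: pointwise.
rewrite big_split /= -/e1 [X in _ <= X / b]mulrDl [X in _ <= X]mulrDl; apply: lerD.
  apply: (@le_trans _ _ (\sum_(d < 2 ^ (2 * q * t)) e1 / b)).
    rewrite big_mkcond; apply: ler_sum => d _; case: ifP => // _.
    apply: divr_ge0 (ltW b_gt0); rewrite /e1.
    have := sqr_ge0 (L%:R ^+ 2 + 1 : R); have := sqr_ge0 (L%:R * (L%:R + 2) : R).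
    by set u := _ ^+ 2; set v := (_ + _) ^+ 2; lra.
  by rewrite sumr_const card_ord -[_ *+ _]mulr_natl mulrA [_ * e1]mulrC.
rewrite -mulr_sumr.
have -> : \sum_(d < 2 ^ (2 * q * t) | odd d) W d =
    pair_sum (2 ^ t) (fun i k => \sum_(d < 2 ^ (2 * q * t) | odd d)
      window_sum R ((q + 4) * t) ((q + 8) * t) ((2 * q + 3) * t) (2 ^ (q * t))
      (shifted_pair L ls i k) d).
  rewrite /W /pair_sum exchange_big /=; apply: eq_bigr => i _.
  by rewrite exchange_big.
apply: (@le_trans _ _ (256 / b / b ^+ 2 * (b ^+ 2 *
   ((16 * (size ls)%:R + 2 + kappa) * b ^+ (2 * q))))).
  apply: ler_wpM2l.
    exact: divr_ge0 (divr_ge0 (ler0n _ _) (ltW b_gt0)) (exprn_ge0 _ (ltW b_gt0)).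
  apply: (le_trans (ler_pair_sum total)); rewrite -bK; apply: pair_sum_const_le.
  by rewrite mulr_ge0 ?exprn_ge0 ?addr_ge0 ?mulr_ge0 //; rewrite bK ltW.
rewrite powE le_eqVlt; apply/orP; left; apply/eqP; field.
by rewrite b_neq0.
Qed.
End AverageOverModuli.

(** * Choice of the parameters *)

Section ParameterChoice.
Variable R : realFieldType.

Lemma bernoulli_ge (x : R) n : 0 <= x -> 1 + n%:R * x <= (1 + x) ^+ n.
Proof.
move=> x_ge0; elim: n => [|n IHn]; first by rewrite mul0r addr0 expr0.
rewrite exprS -natr1; have : 0 <= n%:R * x * x by rewrite !mulr_ge0.
move: IHn; set y := n%:R; set z := _ ^+ n; nra.
Qed.

(** With [x = 2 / P], Bernoulli's inequality gives [(1 + x) ^+ P >= 3], while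
    [(1 - x ^+ 2) ^+ P <= 1]. So every [P] factors gain at least a factor 2. *)
Lemma contraction_decay P E n : (2 <= P)%N -> (P * E <= n)%N ->
  (1 - 2 / P%:R : R) ^+ n <= 2 ^- E.
Proof.
move=> P_ge2 le_n; set x := 2 / P%:R.
have P0 : 0 < P%:R :> R by rewrite ltr0n; lia.
have x_ge0 : 0 <= x by rewrite divr_ge0 // ltW.
have x_le1 : x <= 1 by rewrite ler_pdivrMr // mul1r ler_nat.
have base_ge0 : 0 <= 1 - x by rewrite subr_ge0.
have base_le1 : 1 - x <= 1 by rewrite lerBlDr lerDl.
have half : (1 - x) ^+ P <= 2^-1.
  have h3 : 3 <= (1 + x) ^+ P.
    apply: le_trans (bernoulli_ge P x_ge0); rewrite /x mulrCA divff ?gt_eqF //; lra.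
  have hprod : (1 - x) ^+ P * (1 + x) ^+ P <= 1.
    rewrite -exprMn exprn_ile1 //; last by nra.
    by rewrite mulr_ge0 // addr_ge0.
  have : 0 <= (1 - x) ^+ P by rewrite exprn_ge0.
  move: h3 hprod; set u := _ ^+ P; set v := _ ^+ P; nra.
apply: (@le_trans _ _ ((1 - x) ^+ (P * E))).
  by rewrite ler_wiXn2l.
by rewrite exprM -exprVn; apply: lerXn2r => //; rewrite nnegrE ?exprn_ge0 ?invr_ge0.
Qed.

Lemma shifted_pairE L ls i k : (i <= k)%N ->
  shifted_pair L ls i k =
  [seq (c + L * i)%N | c <- ls ++ [seq (l + L * (k - i))%N | l <- ls]].
Proof.
move=> le_ik; rewrite /shifted_pair map_cat -map_comp; congr (_ ++ _).
by apply: eq_map => l /=; rewrite -addnA -mulnDr subnK.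
Qed.

(** The bound is on the power [m = 2 ^ (size bs).+1], at most [2 ^ (2 * L)]. Of the decay
    [b ^- (2 * L + 20 * 2 ^ (2 * L))], the part [2 * L] absorbs the fibre bounds, each at most
    [2 * L * b], and the rest is still [b ^- 20] after the [m]-th root. *)
Lemma corr_total_le L ls k n t i k' : (0 < L)%N -> ls != [::] -> uniq ls ->
  all (fun l => l < L)%N ls -> ((2 * L + 3) * (2 * L + 3) * 4 <= 2 ^ k)%N ->
  ((2 ^ k) ^ (2 * L + 2) * (2 * L + 20 * 2 ^ (2 * L)) <= n)%N ->
  (i < k' < 2 ^ t)%N ->
  (\sum_(d < 2 ^ (k * (n * t))) \sum_(h < 2 ^ (k * (n * t)))
     corr_sum R (2 ^ (k * (n * t))) (shifted_pair L ls i k') d h)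
    / (2 ^ (k * (n * t)))%:R ^+ 3 <= (2 * L)%:R ^+ (2 * L) / (2 ^+ t) ^+ 20.
Proof.
move=> L_gt0 ls_neq0 ls_uniq /allP ls_lt le_k le_n /andP[lt_ik lt_k].
rewrite shifted_pairE; last exact: ltnW.
set r := (k' - i)%N; have r_gt0 : (0 < r)%N by rewrite subn_gt0.
have r_lt : (r < 2 ^ t)%N by apply: leq_ltn_trans (leq_subr _ _) lt_k.
set cs := ls ++ _.
under eq_bigr => d _ do under eq_bigr => h _ do rewrite corr_sum_shift.
have size_ls : (0 < size ls <= L)%N.
  rewrite lt0n size_eq0 ls_neq0 /= -[X in (_ <= X)%N](size_iota 0).
  by apply: uniq_leq_size => // l /ls_lt; rewrite mem_iota.
have [s [s_gt0 s_le size_cs]] : exists s, [/\ (0 < s)%N, (s <= L)%N &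
    size cs = (s + s)%N].
  by case/andP: size_ls => *; exists (size ls); rewrite size_cat size_map.
have cs_uniq : uniq cs.
  rewrite cat_uniq ls_uniq map_inj_uniq ?ls_uniq ?andbT /=; last exact: addIn.
  apply/hasPn => _ /mapP[l _ ->]; apply/negP => /ls_lt; nia.
have cs_le : {in cs, forall c, c <= 2 * L * 2 ^ t}%N.
  move=> c; rewrite mem_cat => /orP[/ls_lt|/mapP[l /ls_lt lt_l ->]]; nia.
clearbody cs; case: cs size_cs cs_uniq cs_le => [|a bs] /= size_cs cs_uniq cs_le.
  by move: size_cs s_gt0; case: (s).
have bs_le : ((size bs).+1 <= 2 * L)%N by rewrite size_cs mul2n -addnn leq_add.
have le_k' : ((size bs).+4 * (size bs).+4 * 4 <= 2 ^ k)%N.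
  by apply: leq_trans le_k; rewrite leq_mul2r leq_mul // addn3 !ltnS.
have := @corr_sum_bound R k (n * t) a bs _ cs_uniq cs_le le_k'.
set kap := _ / _%:R ^+ 3; set b : R := 2 ^+ t; set A : R := (2 * L)%:R ^+ (2 * L) => bound.
have b_ge1 : 1 <= b by rewrite exprn_ege1 // ler1n.
have b_gt0 : 0 < b by apply: lt_le_trans b_ge1.
have K_gt0 : 0 < (2 ^ k)%:R :> R by rewrite ltr0n expn_gt0.
have K_ge1 : 1 <= (2 ^ k)%:R :> R by rewrite ler1n expn_gt0.
have L2_ge1 : 1 <= (2 * L)%:R :> R by rewrite ler1n muln_gt0.
have A_ge1 : 1 <= A by apply: exprn_ege1.
have kap_ge0 : 0 <= kap.
  rewrite divr_ge0 ?exprn_ge0 // sumr_ge0 // => d _; apply: sumr_ge0 => h _.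
  exact: corr_sum_ge0.
pose m := (2 ^ (size bs).+1)%N.
have m_gt0 : (0 < m)%N by rewrite expn_gt0.
have m_le : (m <= 2 ^ (2 * L))%N by rewrite leq_exp2l.
rewrite -(@ler_pXn2r _ m) ?nnegrE //; last first.
  by rewrite divr_ge0 ?exprn_ge0 // (le_trans ler01).
apply: le_trans bound _.
have theta_le : (1 - 2 / (2 ^ k)%:R ^+ (size bs).+3) ^+ (n * t) <=
    b ^- (2 * L + 20 * 2 ^ (2 * L)).
  have K2 : (2 <= 2 ^ k)%N.
    rewrite -[X in (X <= _)%N]expn1 leq_exp2l // lt0n; apply: contraTneq le_k => ->.
    by rewrite expn0 -ltnNge (@leq_trans 4) // leq_pmull // muln_gt0 addn_gt0 orbT.
  have K2' : (2 <= (2 ^ k) ^ (2 * L + 2))%N.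
    by apply: (leq_trans K2); rewrite -[X in (X <= _)%N]expn1 leq_exp2l // addn2.
  have P_gt0 : 0 < ((2 ^ k) ^ (2 * L + 2))%:R :> R.
    by rewrite ltr0n expn_gt0 expn_gt0.
  apply: (@le_trans _ _ ((1 - 2 / ((2 ^ k) ^ (2 * L + 2))%:R) ^+ (n * t))).
    have th0 : 0 <= 1 - 2 / (2 ^ k)%:R ^+ (size bs).+3 :> R.
      rewrite subr_ge0 ler_pdivrMr ?exprn_gt0 // mul1r -natrX ler_nat.
      by apply: (leq_trans K2); rewrite -[X in (X <= _)%N]expn1 leq_exp2l.
    have th1 : 1 - 2 / (2 ^ k)%:R ^+ (size bs).+3 <=
        1 - 2 / ((2 ^ k) ^ (2 * L + 2))%:R :> R.
      rewrite lerD2l lerN2 ler_pM2l // lef_pV2 ?posrE ?exprn_gt0 //.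
      by rewrite (natrX _ (2 ^ k)) ler_weXn2l // addn2 !ltnS.
    by rewrite lerXn2r ?nnegrE // (le_trans th0).
  have -> : b ^- (2 * L + 20 * 2 ^ (2 * L)) = (2 ^- (2 * L + 20 * 2 ^ (2 * L))) ^+ t.
    by rewrite /b exprVn -!exprM mulnC.
  rewrite exprM; apply: lerXn2r; last exact: contraction_decay.
    by rewrite nnegrE exprn_ge0 // subr_ge0 ler_pdivrMr ?mul1r ?ler_nat //.
  by rewrite nnegrE invr_ge0 exprn_ge0.
have B_le : ((2 * L * 2 ^ t)%:R : R) ^+ size bs <= A * b ^+ (2 * L).
  rewrite natrM natrX -/b -exprMn ler_weXn2l //; last exact: ltnW.
  by apply: le_trans (ler_pM ler01 ler01 L2_ge1 b_ge1); rewrite mul1r.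
apply: le_trans (ler_wpM2l _ theta_le) _; first by rewrite exprn_ge0.
apply: le_trans (ler_wpM2r _ B_le) _.
  by rewrite invr_ge0 exprn_ge0 // ltW.
rewrite exprD invfM -mulrA [X in A * X]mulrA divff ?expf_neq0 ?gt_eqF // mul1r.
rewrite expr_div_n -[(b ^+ 20) ^+ m]exprM; apply: ler_pM.
- exact: le_trans A_ge1.
- by rewrite invr_ge0 exprn_ge0 // ltW.
- by rewrite -[X in X <= _]expr1 ler_weXn2l.
- by rewrite lef_pV2 ?posrE ?exprn_gt0 // ler_weXn2l // leq_mul2l m_le orbT.
Qed.

(* For moduli up to [2 ^ (2 q t)], progressions with [2 ^ ((q + 9) t)] terms are
   long enough: a large [q] brings their length close to the square root of
   the modulus. *)
Lemma progression_bound L q0 : (0 < L)%N -> exists q, (q0 <= q)%N /\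
  exists C : R, 0 <= C /\ forall ls t, ls != [::] -> uniq ls ->
    all (fun l => l < L)%N ls -> (0 < t)%N ->
  exists B : nat -> R, [/\ forall d, 0 <= B d,
    forall d j, odd d -> (d < 2 ^ (2 * q * t))%N ->
      (\sum_(n < 2 ^ ((q + 9) * t)) word R ls d j n) ^+ 4 <=
      (2 ^ ((q + 9) * t))%:R ^+ 4 * B d &
    \sum_(d < 2 ^ (2 * q * t) | odd d) B d <= C * (2 ^ (2 * q * t))%:R / 2 ^+ t].
Proof.
move=> L_gt0; pose k := ((2 * L + 3) * (2 * L + 3) * 4)%N.
have le_k : ((2 * L + 3) * (2 * L + 3) * 4 <= 2 ^ k)%N by rewrite ltnW // ltn_expl.
pose n := ((2 ^ k) ^ (2 * L + 2) * (2 * L + 20 * 2 ^ (2 * L)) + q0 + 20)%N.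
(* Then [rho = (q + 8) * t] equals [k * (n * t)], a whole number of blocks of [k] digits. *)
exists (k * n - 8)%N; have k_gt0 : (0 < k)%N by rewrite /k; nia.
have n_ge : (q0 + 20 <= n)%N by rewrite /n -addnA leq_addl.
have n_ge' : ((2 ^ k) ^ (2 * L + 2) * (2 * L + 20 * 2 ^ (2 * L)) <= n)%N.
  by rewrite /n -addnA leq_addr.
clearbody n k; have kn_ge : (q0 + 20 <= k * n)%N by nia.
split; first by lia.
set q := (k * n - 8)%N; have q8 : (q + 8 = k * n)%N by rewrite subnK //; lia.
have q_ge : (5 <= q)%N by lia.
pose kappa : R := (2 * L)%:R ^+ (2 * L).
exists (8 * (L%:R ^+ 2 + 1) ^+ 2 + 256 * (L%:R * (L%:R + 2)) ^+ 2 + 256 +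
    256 * (16 * L%:R + 2 + kappa)); split.
  have kappa_ge0 : 0 <= kappa by rewrite exprn_ge0.
  have := sqr_ge0 (L%:R ^+ 2 + 1 : R); have := sqr_ge0 (L%:R * (L%:R + 2) : R).
  have : 0 <= L%:R :> R by [].
  by set u := _ ^+ 2; set v := (_ + _) ^+ 2; lra.
move=> ls t ls_neq0 ls_uniq ls_lt t_gt0.
exists (fun d => fourth_power_bound R L ls (2 ^ t) (2 ^ (q * t))
     (2 ^ ((q + 9) * t)) ((q + 4) * t) ((q + 8) * t) ((2 * q + 3) * t) d).
split=> [d|d j odd_d lt_d|]; first exact: fourth_power_bound_ge0.
  apply: word_fourth_power_le => //; rewrite ?expn_gt0 //.
  - by rewrite ltn_mul2r t_gt0 /=; lia.
  - by rewrite leq_mul2r; lia.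
  - by rewrite dvdn_exp2l // leq_mul2r; lia.
apply: le_trans (@fourth_power_total R L ls q t kappa L_gt0 q_ge t_gt0 _ _) _.
- by rewrite exprn_ge0.
- by move=> i k' lt_ik; rewrite q8 -mulnA; apply: corr_total_le.
- rewrite ler_wpM2r ?invr_ge0 ?exprn_ge0 // ler_wpM2r // lerD2l ler_pM2l //.
  rewrite !lerD2r ler_pM2l // ler_nat -[X in (_ <= X)%N](size_iota 0).
  apply: uniq_leq_size => // l; move/allP: ls_lt => h /h.
  by rewrite mem_iota.
Qed.
End ParameterChoice.

(** * From words to sign sums *)

Definition word_test L (omega : L.-tuple bool) d j i :=
  [forall l : 'I_L, odd (binary_ones ((i + l) * d + j)) == tnth omega l].

Lemma word_atP L (omega : L.-tuple bool) (d j' i : nat) (j n0 : int) :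
  n0 * d%:Z + j = j'%:Z ->
  reflect (word_at omega d j (n0 + i%:Z)) (word_test omega d j' i).
Proof.
move=> def_j'; have absE (l : 'I_L) :
    absz ((n0 + i%:Z + l%:Z) * d%:Z + j) = ((i + l) * d + j')%N.
  have -> : (n0 + i%:Z + l%:Z) * d%:Z + j = (n0 * d%:Z + j) + (i + l)%:Z * d%:Z.
    by rewrite PoszD; ring.
  by rewrite def_j' -PoszM -PoszD absz_nat addnC.
apply: (iffP forallP) => h l; move: (h l); rewrite absE.
  by move/eqP => h'; rewrite !modn2 h' oddb.
by rewrite !modn2 oddb; case: (odd _); case: (tnth _ _).
Qed.

(** The admissible [n] form an interval starting at [n0]. Moving [n0] into the offset yields [j'],
    which is a natural number because the first term is at least [y >= 0]. In this way [y], [z] and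
    [j] leave the problem: only a length and an arbitrary natural offset remain. *)
Lemma word_count_sum (R : realType) L (omega : L.-tuple bool) (y z : R) d (j : int) :
  (0 < d)%N -> 0 <= y <= z -> exists (N j' : nat),
  `|N%:R - (z - y) / d%:R| <= 1 /\
  word_count omega y z d j = (\sum_(i < N) word_test omega d j' i)%N.
Proof.
move=> d_gt0 /andP[y_ge0 le_yz].
have d0 : 0 < d%:R :> R by rewrite ltr0n.
pose a := (y - j%:~R) / d%:R; pose b := (z - j%:~R) / d%:R.
pose n0 := Num.ceil a; pose n1 := Num.ceil b.
have le_ab : a <= b by rewrite ler_pM2r ?invr_gt0 // lerD2r.
have le_n : n0 <= n1 by apply: le_ceil.
have leP (n : int) : (n0 <= n) = (y <= (n * d%:Z + j)%:~R).
  rewrite /n0 ceil_le_int /a ler_pdivrMr // lerBlDr.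
  by rewrite intrD intrM.
have ltP (n : int) : (n < n1) = ((n * d%:Z + j)%:~R < z).
  rewrite /n1 ceil_gt_int /b ltr_pdivlMr // ltrBrDr.
  by rewrite intrD intrM.
have [N def_N] : exists N : nat, n1 = n0 + N%:Z.
  by exists (absz (n1 - n0)); rewrite gez0_abs ?subr_ge0 // subrKC.
have [j' def_j'] : exists j' : nat, n0 * d%:Z + j = j'%:Z.
  exists (absz (n0 * d%:Z + j)); rewrite gez0_abs // -(ler0z R).
  by apply: le_trans y_ge0 _; rewrite -leP.
exists N, j'; split.
  have -> : (z - y) / d%:R = b - a by rewrite /a /b; field; rewrite gt_eqF.
  have := ceil_itv a; have := ceil_itv b; rewrite -/n0 -/n1 def_N !intrD.
  by rewrite ler_norml => /andP[h1 h2] /andP[h3 h4]; lra.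
pose f (i : nat) : int := (n0 + i%:Z) * d%:Z + j.
have f_inj : injective f.
  have d_neq0 : d%:Z != 0 by rewrite eqz_nat -lt0n.
  by move=> i1 i2 /addIr /(mulIf d_neq0) /addrI [].
pose s := [seq f i | i <- iota 0 N & word_test omega d j' i].
rewrite /word_count.
have -> : word_positions omega y z d j = [set` [fset x in s]%fset]%classic.
  apply/seteqP; split=> m /=; rewrite /word_positions /= inE.
    move=> [/andP[le_y lt_z] [n [def_m at_n]]].
    have le_n0 : n0 <= n by rewrite leP -def_m.
    have lt_n1 : n < n1 by rewrite ltP -def_m.
    have def_n : n = n0 + (absz (n - n0))%:Z.
      by rewrite gez0_abs ?subr_ge0 // subrKC.
    apply/mapP; exists (absz (n - n0)); last by rewrite /f -def_n.
    rewrite mem_filter mem_iota /= add0n; apply/andP; split.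
      by apply/(word_atP omega _ def_j'); rewrite -def_n.
    by move: lt_n1; rewrite {1}def_n def_N ltrD2l ltz_nat.
  move=> /mapP[i]; rewrite mem_filter mem_iota /= add0n => /andP[test_i lt_i] ->.
  split; last by exists (n0 + i%:Z); split=> //; apply/(word_atP omega _ def_j').
  by rewrite /f -leP -ltP lerDl def_N ltrD2l ltz_nat lt_i andbT.
rewrite set_fsetK card_fseq undup_id; last first.
  by rewrite map_inj_uniq // filter_uniq // iota_uniq.
rewrite size_map size_filter -sum1_count big_mkcond /=.
rewrite -{1}(subn0 N) -/(index_iota 0 N) big_mkord.
by apply: eq_bigr => i _; case: word_test.
Qed.

(** * Blocks, odd moduli and expansion into signs *)

Section Reduction.
Variable R : realFieldType.

Lemma word_shift ls d j n m : word R ls d j (m + n) = word R ls d (m * d + j) n.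
Proof.
by apply: eq_bigr => l _; congr (tau R _); rewrite -addnA mulnDl -addnA addnCA.
Qed.

Lemma word_blocks ls d N K : 0 <= K ->
  (forall j, `|\sum_(n < N) word R ls d j n| <= K) -> (0 < N)%N ->
  forall m j, `|\sum_(n < m) word R ls d j n| <= m%:R / N%:R * K + N%:R.
Proof.
move=> K_ge0 hK N_gt0 m j; have N0 : 0 < N%:R :> R by rewrite ltr0n.
have short r i : `|\sum_(n < r) word R ls d i n| <= r%:R.
  apply: le_trans (ler_norm_sum _ _ _) _.
  rewrite -[X in _ <= X%:R]card_ord -sum1_card natr_sum; apply: ler_sum => n _.
  by rewrite prod_tau_norm.
have blocks Q r i : `|\sum_(n < Q * N + r) word R ls d i n| <= Q%:R * K + r%:R.
  elim: Q i => [|Q IHQ] i; first by rewrite mul0n add0n mul0r add0r.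
  rewrite mulSn -addnA big_split_ord /=; apply: le_trans (ler_normD _ _) _.
  rewrite -natr1 mulrDl mul1r [_ * K + K]addrC -addrA; apply: lerD; first exact: hK.
  by under eq_bigr => n _ do rewrite word_shift.
rewrite (divn_eq m N); apply: le_trans (blocks _ _ _) _; apply: lerD.
  rewrite ler_wpM2r // ler_pdivlMr // -natrM ler_nat; exact: leq_addr.
by rewrite ler_nat ltnW // ltn_mod.
Qed.

Definition odd_part d := (d %/ 2 ^ logn 2 d)%N.

Lemma odd_partE d : (d = 2 ^ logn 2 d * odd_part d)%N.
Proof. by rewrite mulnC divnK // pfactor_dvdnn. Qed.

Lemma odd_part_odd d : (0 < d)%N -> odd (odd_part d).
Proof.
move=> d_gt0; have [m co_m def_d] := pfactor_coprime (isT : prime 2) d_gt0.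
by rewrite /odd_part {1}def_d mulnK ?expn_gt0 // -coprime2n.
Qed.

Lemma odd_part_le d : (odd_part d <= d)%N.
Proof. exact: leq_div. Qed.

(** The lowest [v] digits of every argument are those of [j], so they contribute a constant sign. *)
Lemma word_even_modulus ls d j v n : word R ls (2 ^ v * d) j n =
  tau R (j %% 2 ^ v) ^+ size ls * word R ls d (j %/ 2 ^ v) n.
Proof.
rewrite /word.
under eq_bigr => l _.
  have -> : ((n + l) * (2 ^ v * d) + j =
      2 ^ v * ((n + l) * d + j %/ 2 ^ v) + j %% 2 ^ v)%N.
    rewrite {1}(divn_eq j (2 ^ v)) addnA; congr addn.
    by rewrite mulnDr mulnCA [(_ * 2 ^ v)%N]mulnC.
  rewrite tau_split ?ltn_mod ?expn_gt0 // mulrC.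
  over.
by rewrite big_split big_const_seq count_predT iter_mulr_1.
Qed.

Lemma word_sum_odd_part ls d j N : `|\sum_(n < N) word R ls d j n| =
  `|\sum_(n < N) word R ls (odd_part d) (j %/ 2 ^ logn 2 d) n|.
Proof.
rewrite {1}(odd_partE d).
under eq_bigr => n _ do rewrite word_even_modulus.
by rewrite -mulr_sumr normrM normrX tau_norm expr1n mul1r.
Qed.

(** A modulus is determined by its odd part and its 2-adic valuation, and the latter takes at most
    [beta] values. *)
Lemma sum_odd_part beta (F : nat -> R) : (forall d, 0 <= F d) ->
  \sum_(d < 2 ^ beta | (0 < d)%N) F (odd_part d) <=
  beta%:R * \sum_(d < 2 ^ beta | odd d) F d.
Proof.
move=> F_ge0; have [->|beta_gt0] := posnP beta.
  by rewrite mul0r big1 // => -[[]].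
pose phi (d : 'I_(2 ^ beta)) : 'I_beta.-1.+1 * 'I_(2 ^ beta) :=
  (inord (logn 2 d), Ordinal (leq_ltn_trans (odd_part_le d) (ltn_ord d))).
pose G (x : 'I_beta.-1.+1 * 'I_(2 ^ beta)) := if odd x.2 then F x.2 else 0.
have lt_log (d : 'I_(2 ^ beta)) : (0 < d)%N -> (logn 2 d < beta.-1.+1)%N.
  move=> d_gt0; rewrite prednK // -(@ltn_exp2l 2) //.
  apply: leq_ltn_trans (ltn_ord d); apply: dvdn_leq => //.
  by rewrite pfactor_dvdnn.
have -> : beta%:R * \sum_(d < 2 ^ beta | odd d) F d = \sum_x G x.
  transitivity (\sum_(i < beta.-1.+1) \sum_(d < 2 ^ beta) G (i, d)); last first.
    by rewrite pair_big; apply: eq_bigr => -[].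
  by rewrite /G /= sumr_const card_ord prednK // mulr_natl -big_mkcond.
rewrite (eq_bigr (fun d => G (phi d))); last first.
  by move=> d d_gt0; rewrite /G /= odd_part_odd.
apply: (@sum_inj_le R _ _ (fun d : 'I_(2 ^ beta) => (0 < d)%N)).
  by move=> x; rewrite /G; case: ifP.
move=> d1 d2 d1_gt0 d2_gt0 [] /(congr1 val); rewrite /= !inordK ?lt_log // => eq_log eq_odd.
by apply: val_inj; rewrite /= (odd_partE d1) (odd_partE d2) eq_odd eq_log.
Qed.

Definition letters L (A : {set 'I_L}) : seq nat := [seq val l | l <- enum A].

Lemma letters_lt L (A : {set 'I_L}) : all (fun l => l < L)%N (letters A).
Proof. by apply/allP => _ /mapP[l _ ->]; apply: ltn_ord. Qed.

Lemma letters_uniq L (A : {set 'I_L}) : uniq (letters A).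
Proof. by rewrite map_inj_uniq ?enum_uniq //; apply: val_inj. Qed.

Lemma letters_neq0 L (A : {set 'I_L}) : A != finset.set0 -> letters A != [::].
Proof.
apply: contraNneq => /(congr1 size); rewrite size_map -cardE => /eqP.
by rewrite cards_eq0.
Qed.

Lemma word_letters L (A : {set 'I_L}) d j n :
  word R (letters A) d j n = \prod_(l in A) tau R ((n + l) * d + j).
Proof. by rewrite /word big_map big_enum. Qed.

Lemma odd_sign (b c : bool) : ((b == c)%:R : R) = (1 + (-1) ^+ c * (-1) ^+ b) / 2.
Proof. by case: b; case: c; rewrite /= ?expr1 ?expr0; lra. Qed.

Lemma word_test_expand L (omega : L.-tuple bool) d j n :
  (word_test omega d j n)%:R = 2 ^- L * \sum_(A : {set 'I_L})
     (\prod_(l in A) (-1) ^+ tnth omega l) * word R (letters A) d j n.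
Proof.
have -> : (word_test omega d j n)%:R = \prod_(l < L)
    ((odd (binary_ones ((n + l) * d + j)) == tnth omega l)%:R : R).
  rewrite /word_test; case: forallP => [h|/forallP].
    by rewrite big1 // => l _; rewrite h.
  rewrite negb_forall => /existsP[l /negbTE h].
  by rewrite (bigD1 l) //= h mul0r.
under eq_bigr => l _ do rewrite odd_sign signr_odd -/(tau R _) addrC.
rewrite big_split /= prodr_const card_ord -exprVn mulrC; congr (_ * _).
rewrite bigA_distr /=; apply: eq_bigr => A _.
rewrite word_letters -big_split [RHS]big_mkcond /=.
by apply: eq_bigr => l _.
Qed.

(** In the expansion, the empty set of letters contributes exactly the expected main term. *)
Lemma word_test_discrepancy L (omega : L.-tuple bool) d j N :
  `|(\sum_(n < N) word_test omega d j n)%N%:R - N%:R / 2 ^+ L| <=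
  \sum_(A : {set 'I_L} | A != finset.set0) `|\sum_(n < N) word R (letters A) d j n|.
Proof.
rewrite natr_sum; under eq_bigr => n _ do rewrite word_test_expand.
rewrite -mulr_sumr exchange_big /= (bigD1 finset.set0) //=.
rewrite [X in _ * (X + _)](eq_bigr (fun=> 1)); last first.
  move=> n _; rewrite big_set0 mul1r word_letters big_set0 //.
rewrite sumr_const card_ord mulrDr -mulr_natl mulr1 [_^-1 * _]mulrC addrAC subrr add0r.
rewrite normrM ger0_norm ?invr_ge0 ?exprn_ge0 //.
apply: (@le_trans _ _ (1 * `|\sum_(A : {set 'I_L} | A != finset.set0)
    \sum_(n < N) (\prod_(l in A) (-1) ^+ tnth omega l) * word R (letters A) d j n|)).
  by rewrite ler_wpM2r // invf_le1 ?exprn_gt0 // exprn_ege1 // ler1n.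
rewrite mul1r; apply: le_trans (ler_norm_sum _ _ _) _; apply: ler_sum => A _.
rewrite -mulr_sumr normrM normr_prod big1 ?mul1r // => l _.
by rewrite normrX normrN1 expr1n.
Qed.
End Reduction.

(** * The total discrepancy *)

(* This replaces taking fourth roots of [B]. *)
Lemma quartic_le (R : realFieldType) (s c B : R) : 0 <= s -> 0 < c ->
  s ^+ 4 <= B -> s <= c + B / c ^+ 3.
Proof.
move=> s_ge0 c_gt0 s4_le; have c3 := exprn_gt0 3 c_gt0.
have B_ge0 : 0 <= B by apply: le_trans s4_le; rewrite exprn_ge0.
have [le_sc|lt_cs] := leP s c.
  by apply: le_trans le_sc _; rewrite lerDl divr_ge0 // ltW.
apply: (@le_trans _ _ (B / c ^+ 3)); last by rewrite lerDr ltW.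
rewrite ler_pdivlMr //; apply: le_trans s4_le; rewrite (exprS s 3) ler_wpM2l //.
by rewrite lerXn2r ?nnegrE // ltW.
Qed.

Section Discrepancy.
Variables (R : realType) (L : nat) (omega : L.-tuple bool).

Lemma max_discrepancy_le (x D : R) d N (K : {set 'I_L} -> R) :
  0 < D -> D <= x -> D < d%:R -> (0 < N)%N -> (forall A, 0 <= K A) ->
  (forall A j, A != finset.set0 ->
    `|\sum_(n < N) word R (letters A) d j n| <= N%:R * K A) ->
  (max_discrepancy omega x d <=
   (1 + 2 ^+ L * N%:R + 2 * x / D * \sum_(A | A != finset.set0) K A)%:E)%E.
Proof.
move=> D_gt0 le_Dx lt_Dd N_gt0 K_ge0 hK.
have d0 : 0 < d%:R :> R by apply: lt_trans lt_Dd.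
have d_gt0 : (0 < d)%N by rewrite -(ltr0n R).
have N0 : 0 < N%:R :> R by rewrite ltr0n.
have L0 : 0 < 2 ^+ L :> R by rewrite exprn_gt0.
have L1 : 1 <= 2 ^+ L :> R by rewrite exprn_ege1 // ler1n.
apply: ge_ereal_sup => _ [[y z] /= [le_yz le_x] <-].
apply: ge_ereal_sup => _ [j _ <-]; rewrite lee_fin /=.
have [m [j' [m_near ->]]] := word_count_sum omega j d_gt0 le_yz.
set u := (z - y) / d%:R in m_near.
have -> : (z - y) / (2 ^+ L * d%:R) = u / 2 ^+ L.
  by rewrite /u; field; rewrite !gt_eqF.
have m_le : m%:R <= 2 * x / D.
  have u_le : u <= x / D.
    have x_ge0 : 0 <= x by apply: le_trans le_Dx; rewrite ltW.
    apply: (@le_trans _ _ (x / d%:R)); first by rewrite ler_pM2r ?invr_gt0.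
    by rewrite ler_wpM2l // lef_pV2 ?posrE // ltW.
  have one_le : 1 <= x / D by rewrite ler_pdivlMr // mul1r.
  by move: m_near; rewrite ler_norml -mulrA => /andP[_]; lra.
have near : `|m%:R / 2 ^+ L - u / 2 ^+ L| <= 1.
  have inv_le1 : `|(2 ^+ L)^-1| <= 1 :> R.
    by rewrite ger0_norm ?invr_ge0 ?(ltW L0) // invf_le1.
  rewrite -mulrBl normrM -[X in _ <= X]mulr1.
  exact: ler_pM (normr_ge0 _) (normr_ge0 _) m_near inv_le1.
have main := word_test_discrepancy R omega d j' m.
set S := \sum_(i < m) _ in main *.
have -> : S%:R - u / 2 ^+ L = (m%:R / 2 ^+ L - u / 2 ^+ L) + (S%:R - m%:R / 2 ^+ L) by ring.
apply: le_trans (ler_normD _ _) _; rewrite -addrA; apply: lerD => //.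
apply: le_trans main _.
apply: (@le_trans _ _ (\sum_(A : {set 'I_L} | A != finset.set0) (N%:R + 2 * x / D * K A))).
  apply: ler_sum => A A_neq0; rewrite addrC.
  apply: le_trans (word_blocks (mulr_ge0 (ler0n _ _) (K_ge0 A)) _ N_gt0 _ _) _.
    by move=> i; apply: hK.
  rewrite lerD2r mulrA divfK ?gt_eqF // ler_wpM2r //.
rewrite big_split /= -mulr_sumr lerD2r sumr_const -[_ *+ _]mulr_natl ler_wpM2r //.
rewrite -natrX ler_nat -[X in (_ <= 2 ^ X)%N]card_ord -cardsT -card_powerset.
by apply: subset_leq_card; apply/fintype.subsetP => A _; rewrite powersetE finset.subsetT.
Qed.
End Discrepancy.

Section Total.
Variables (R : realType) (L : nat) (omega : L.-tuple bool).

(** With [t = 8 * u] the average of [B] is about [2 ^- (8 * u)]. Dividing by the cube of [2 ^- u]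
    leaves [2 ^- (5 * u)], whose surplus [2 ^- (4 * u)] over [2 ^- u] pays for the factor [u] lost
    in [sum_odd_part]. *)
Lemma sum_linearised (B : nat -> R) (C : R) q u : 0 <= C -> (forall d, 0 <= B d) ->
  \sum_(d < 2 ^ (2 * q * (8 * u)) | odd d) B d <=
    C * (2 ^ (2 * q * (8 * u)))%:R / 2 ^+ (8 * u) ->
  \sum_(d < 2 ^ (2 * q * (8 * u)) | (0 < d)%N)
    (2 ^- u + B (odd_part d) / (2 ^- u) ^+ 3) <=
  (2 ^ (2 * q * (8 * u)))%:R * 2 ^- u * (1 + 16 * q%:R * C).
Proof.
move=> C_ge0 B_ge0 total; set beta := (2 * q * (8 * u))%N in total *.
set n : R := (2 ^ beta)%:R in total *.
set b : R := 2 ^+ u; have b_gt0 : 0 < b by rewrite exprn_gt0.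
have b_neq0 : b != 0 by rewrite gt_eqF.
have b8 : 2 ^+ (8 * u) = b ^+ 8 :> R by rewrite mulnC exprM.
rewrite big_split /= mulrDr mulr1; apply: lerD.
  apply: (@le_trans _ _ (\sum_(d < 2 ^ beta) b^-1)).
    rewrite big_mkcond; apply: ler_sum => d _; case: ifP => // _.
    by rewrite invr_ge0 ltW.
  by rewrite sumr_const card_ord -[_ *+ _]mulr_natl.
rewrite -mulr_suml exprVn invrK.
apply: (@le_trans _ _ (beta%:R * (C * n / b ^+ 8) * b ^+ 3)).
  rewrite ler_wpM2r ?exprn_ge0 ?(ltW b_gt0) //.
  apply: le_trans (sum_odd_part beta B_ge0) _.
  by rewrite ler_wpM2l // -b8.
have u_le : u%:R <= b ^+ 4.
  rewrite -exprM -natrX ler_nat; apply: leq_trans (ltnW (ltn_expl u (isT : 1 < 2)%N)) _.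
  by rewrite leq_exp2l // leq_pmulr.
have n_ge0 : 0 <= n by [].
rewrite /beta !natrM.
have -> : 2 * q%:R * (8 * u%:R) * (C * n / b ^+ 8) * b ^+ 3 =
   n / b * (16 * q%:R * C) * (u%:R / b ^+ 4) by field.
rewrite -[X in _ <= X]mulr1 ler_wpM2l //.
  by rewrite !mulr_ge0 ?invr_ge0 // ltW.
by rewrite ler_pdivrMr ?exprn_gt0 // mul1r.
Qed.

Lemma total_discrepancy_le q (C : R) : (0 < L)%N -> 0 <= C ->
  (forall ls t, ls != [::] -> uniq ls ->
    all (fun l => l < L)%N ls -> (0 < t)%N ->
  exists B : nat -> R, [/\ forall d, 0 <= B d,
    forall d j, odd d -> (d < 2 ^ (2 * q * t))%N ->
      (\sum_(n < 2 ^ ((q + 9) * t)) word R ls d j n) ^+ 4 <=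
      (2 ^ ((q + 9) * t))%:R ^+ 4 * B d &
    \sum_(d < 2 ^ (2 * q * t) | odd d) B d <= C * (2 ^ (2 * q * t))%:R / 2 ^+ t]) ->
  forall (x D : R) u, 1 <= D -> D <= x -> (0 < u)%N ->
  2 * D < (2 ^ (2 * q * (8 * u)))%:R ->
  (\sum_(d < (Num.truncn (2 * D)).+1 | (D < d%:R <= 2 * D)%R)
     max_discrepancy omega x d <=
   (3 * D * (1 + 2 ^+ L * (2 ^ ((q + 9) * (8 * u)))%:R) +
    2 * x / D * (2 ^+ L * ((2 ^ (2 * q * (8 * u)))%:R * 2 ^- u *
      (1 + 16 * q%:R * C))))%:E)%E.
Proof.
move=> L_gt0 C_ge0 hB x D u D_ge1 le_Dx u_gt0 lt_n.
have D_gt0 : 0 < D by apply: lt_le_trans D_ge1.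
have x_ge0 : 0 <= x by apply: le_trans le_Dx; rewrite ltW.
set n := (2 ^ (2 * q * (8 * u)))%N in lt_n *.
set N := (2 ^ ((q + 9) * (8 * u)))%N.
have c_gt0 : 0 < 2 ^- u :> R by rewrite invr_gt0 exprn_gt0.
have t_gt0 : (0 < 8 * u)%N by rewrite muln_gt0.
have N_gt0 : (0 < N)%N by rewrite expn_gt0.
have N0 : 0 < N%:R :> R by rewrite ltr0n.
(* The empty set is included, with the bound 0, so that [choice] gives a family indexed by all
   [A]. *)
have B_ex (A : {set 'I_L}) : exists B : nat -> R, [/\ forall d, 0 <= B d,
    A != finset.set0 -> forall d j, odd d -> (d < n)%N ->
      (\sum_(n < N) word R (letters A) d j n) ^+ 4 <= N%:R ^+ 4 * B d &
    \sum_(d < n | odd d) B d <= C * n%:R / 2 ^+ (8 * u)].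
  have [->|A_neq0] := eqVneq A finset.set0.
    exists (fun=> 0); split=> //.
    by rewrite big1 // divr_ge0 ?exprn_ge0 // mulr_ge0.
  have [B [B1 B2 B3]] := hB _ _ (letters_neq0 A_neq0) (letters_uniq A)
    (letters_lt A) t_gt0.
  by exists B; split.
have [B hBA] := choice B_ex.
(* The right-hand side of [quartic_le] with [c = 2 ^- u]. *)
pose K d (A : {set 'I_L}) : R := 2 ^- u + B A (odd_part d) / (2 ^- u) ^+ 3.
have K_ge0 d A : 0 <= K d A.
  have [B_ge0 _ _] := hBA A.
  by rewrite addr_ge0 ?divr_ge0 ?exprn_ge0 // ltW.
have le_n : ((Num.truncn (2 * D)).+1 <= n)%N.
  rewrite -(ltr_nat R); apply: le_lt_trans lt_n; rewrite truncn_le //.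
  by rewrite mulr_ge0 // ltW.
pose F d : R := 1 + 2 ^+ L * N%:R + 2 * x / D * \sum_(A | A != finset.set0) K d A.
have F_ge0 d : 0 <= \sum_(A | A != finset.set0) K d A by apply: sumr_ge0.
apply: (@le_trans _ _ (\sum_(d < (Num.truncn (2 * D)).+1 | (D < d%:R <= 2 * D)%R)
   (F d)%:E)%E).
  apply: lee_sum => d /andP[lt_Dd _].
  apply: max_discrepancy_le => // A j A_neq0.
  have [B_ge0 B4 _] := hBA A.
  have d_gt0 : (0 < d)%N by rewrite -(ltr0n R); apply: lt_trans lt_Dd.
  rewrite word_sum_odd_part -ler_pdivrMl //.
  apply: quartic_le => //.
  have := B4 A_neq0 (odd_part d) (j %/ 2 ^ logn 2 d)%N (odd_part_odd d_gt0).
  move=> /(_ (leq_ltn_trans (odd_part_le d) (leq_trans (ltn_ord d) le_n))).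
  rewrite exprMn exprVn ler_pdivrMl ?exprn_gt0 //; apply: le_trans.
  by rewrite -[4%N]/(2 * 2)%N !exprM real_normK ?num_real.
rewrite sumEFin lee_fin big_split /=; apply: lerD.
  apply: (@le_trans _ _ (\sum_(d < (Num.truncn (2 * D)).+1) (1 + 2 ^+ L * N%:R))).
    by rewrite big_mkcond; apply: ler_sum => d _; case: ifP.
  rewrite sumr_const card_ord -[_ *+ _]mulr_natl ler_wpM2r //.
  rewrite -natr1; have : (Num.truncn (2 * D))%:R <= 2 * D.
    by rewrite truncn_le // mulr_ge0 // ltW.
  by move: D_ge1; set v := _%:R; lra.
rewrite -mulr_sumr ler_wpM2l ?divr_ge0 ?mulr_ge0 ?(ltW D_gt0) //.
apply: (@le_trans _ _ (\sum_(d < n | (0 < d)%N) \sum_(A | A != finset.set0) K d A)).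
  apply: (@le_trans _ _ (\sum_(d < (Num.truncn (2 * D)).+1 | (0 < d)%N)
      \sum_(A | A != finset.set0) K d A)).
    rewrite big_mkcond [X in _ <= X]big_mkcond; apply: ler_sum => d _.
    case: ifP => [/andP[lt_Dd _]|_]; last by case: ifP.
    by rewrite -(ltr0n R) (lt_trans D_gt0).
  exact: (@ler_sum_widen R _ n (fun d => 0 < d)%N
    (fun d => \sum_(A | A != finset.set0) K d A) le_n F_ge0).
rewrite exchange_big /=.
apply: (@le_trans _ _ (\sum_(A : {set 'I_L}) n%:R * 2 ^- u * (1 + 16 * q%:R * C))).
  rewrite big_mkcond; apply: ler_sum => A _; case: ifP => _.
    by have [B_ge0 _ B_tot] := hBA A; apply: sum_linearised.
  by rewrite mulr_ge0 ?addr_ge0 ?mulr_ge0 // ltW.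
rewrite sumr_const -[_ *+ _]mulr_natl ler_wpM2r //.
  by rewrite mulr_ge0 ?addr_ge0 ?mulr_ge0 // ltW.
by rewrite -natrX ler_nat -cardsT -powersetT card_powerset cardsT card_ord.
Qed.
End Total.

(** * Comparison of the dyadic scales with real powers *)

Section PowerEstimates.
Variable R : realType.

Lemma powR_half_le (x D delta : R) q u : (0 < q)%N -> 1 <= x ->
  x `^ delta <= D -> D <= (2 ^ (2 * q * (8 * u)))%:R ->
  2 ^- u <= x `^ (- (delta / (16 * q%:R))).
Proof.
move=> q_gt0 x_ge1 le_D D_le.
have q0 : 0 < 16 * q%:R :> R by rewrite mulr_gt0 // ltr0n.
have x_gt0 : 0 < x by apply: lt_le_trans x_ge1.
rewrite powRN lef_pV2 ?posrE ?exprn_gt0 ?powR_gt0 //.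
rewrite powRrM; have -> : 2 ^+ u = ((2 ^ (2 * q * (8 * u)))%:R : R) `^ (16 * q%:R)^-1.
  have -> : (2 * q * (8 * u) = u * (16 * q))%N by lia.
  rewrite natrX exprM -(powR_mulrn (16 * q)) ?exprn_ge0 // -powRrM natrM.
  by rewrite divff ?gt_eqF // powRr1 // exprn_ge0.
apply: ge0_ler_powR; rewrite ?nnegrE ?invr_ge0 ?powR_ge0 ?(ltW q0) //.
exact: le_trans le_D D_le.
Qed.

Lemma powR_length_le (c D : R) q u : (0 < q)%N -> 0 <= D -> 0 <= c ->
  (2 ^ (2 * q * (8 * u)))%:R <= c * D ->
  (2 ^ ((q + 9) * (8 * u)))%:R <=
    c `^ ((q + 9)%:R / (2 * q%:R)) * D `^ ((q + 9)%:R / (2 * q%:R)).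
Proof.
move=> q_gt0 D_ge0 c_ge0 n_le.
have q0 : 0 < 2 * q%:R :> R by rewrite mulr_gt0 // ltr0n.
rewrite -powRM //.
have -> : (2 ^ ((q + 9) * (8 * u)))%:R =
    ((2 ^ (2 * q * (8 * u)))%:R : R) `^ ((q + 9)%:R / (2 * q%:R)).
  have -> : (2 * q * (8 * u) = 8 * u * (2 * q))%N by lia.
  rewrite [in RHS]natrX [in RHS]exprM -(powR_mulrn (2 * q)) ?exprn_ge0 //.
  rewrite -powRrM natrM mulrCA divff ?gt_eqF // mulr1 powR_mulrn ?exprn_ge0 //.
  by rewrite -exprM -natrX mulnC.
by rewrite ge0_ler_powR ?nnegrE ?divr_ge0 ?mulr_ge0 ?(ltW q0).
Qed.

(** The least admissible [u] is taken. Decreasing it by 1 divides the scale by [2 ^ (16 * q)], so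
    minimality gives the upper bound. *)
Lemma dyadic_scale (D : R) q : (0 < q)%N -> 1 <= D -> exists u, [/\ (0 < u)%N,
  2 * D < (2 ^ (2 * q * (8 * u)))%:R & (2 ^ (2 * q * (8 * u)))%:R <= 2 ^+ (16 * q + 1) * D].
Proof.
move=> q_gt0 D_ge1.
have [|u lt_u u_min] := @ex_minnP (fun u => 2 * D < (2 ^ (2 * q * (8 * u)))%:R).
  exists (Num.truncn (2 * D)).+1; apply: lt_le_trans (truncnS_gt _) _.
  rewrite ler_nat; apply: leq_trans (ltnW (ltn_expl _ (isT : 1 < 2)%N)) _.
  by rewrite leq_exp2l // [X in (_ <= X)%N]mulnA leq_pmull // !muln_gt0 q_gt0.
have u_gt0 : (0 < u)%N.
  case: u lt_u {u_min} => //; rewrite !muln0 expn0; lra.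
exists u; split=> //.
have : ~~ (2 * D < (2 ^ (2 * q * (8 * u.-1)))%:R).
  by apply/negP => /u_min; rewrite leqNgt prednK // leqnn.
rewrite -leNgt => le_D.
have -> : (2 * q * (8 * u) = 16 * q + 2 * q * (8 * u.-1))%N.
  by case: u u_gt0 {lt_u u_min le_D} => // u _ /=; lia.
rewrite expnD natrM natrX exprD expr1 -mulrA ler_wpM2l // exprn_ge0 //.
Qed.
End PowerEstimates.

(** * Choice of the exponents and conclusion *)

Local Open Scope classical_set_scope.
Local Open Scope ring_scope.

Theorem theorem2p1 (R : realType) (L : nat) (hL : (1 <= L)%N)
    (omega : L.-tuple bool) (delta1 delta2 : R)
    (hdelta1 : 0 < delta1) (hdelta12 : delta1 <= delta2)
    (hdelta2 : delta2 < 2 / 3) :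
  exists eta C : R, 0 < eta /\
    forall x D : R, 1 <= x -> x `^ delta1 <= D <= x `^ delta2 ->
      (\sum_(d < (Num.truncn (2 * D)).+1 | (D < d%:R <= 2 * D)%R)
         max_discrepancy omega x d <= (C * x `^ (1 - eta))%:E)%E.
Proof.
(* [e] is the room between [D ^ (3/2)], which is at most [x ^ (3/2 * delta2)], and [x]. *)
pose e := 1 - 3 / 2 * delta2; have e_gt0 : 0 < e by rewrite /e; lra.
have delta2_gt0 : 0 < delta2 by apply: lt_le_trans hdelta12.
(* The length exceeds the square root of the modulus by the exponent [9 / (2 * q)]. Since
   [delta2 < 2 / 3], this costs at most [3 / q] in the exponent of [x], and [q >= 6 / e] keeps it
   below [e / 2]. *)
pose q0 := (Num.truncn (6 / e)).+1.
have [q [le_q [C [C_ge0 hB]]]] := @progression_bound R L q0 hL.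
have q_gt0 : (0 < q)%N by apply: leq_trans le_q.
have qR : 0 < q%:R :> R by rewrite ltr0n.
have q_big : 6 / e <= q%:R.
  by apply: le_trans (ltW (truncnS_gt _)) _; rewrite ler_nat.
pose kappa : R := (q + 9)%:R / (2 * q%:R).
pose c1 : R := 2 ^+ (16 * q + 1).
(* The first entry serves the term [D * N] of incomplete progressions, the second one the saving
   [2 ^- u] in the sign sums. *)
pose eta := Num.min (e / 2) (delta1 / (16 * q%:R)).
pose E : R := 1 + 16 * q%:R * C.
have E_ge0 : 0 <= E by rewrite addr_ge0 // !mulr_ge0.
have c1_ge0 : 0 <= c1 by rewrite exprn_ge0.
have L1 : 1 <= 2 ^+ L :> R by rewrite exprn_ege1 // ler1n.
exists eta, (6 * 2 ^+ L * c1 `^ kappa + 2 * 2 ^+ L * c1 * E); split.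
  by rewrite lt_min !divr_gt0 // mulr_gt0.
move=> x D x_ge1 /andP[le_xD le_Dx].
have x_gt0 : 0 < x by apply: lt_le_trans x_ge1.
have x_neq0 : x != 0 by rewrite gt_eqF.
have D_ge1 : 1 <= D.
  by apply: le_trans le_xD; rewrite -(powRr0 x) ler_powR // ltW.
have D_gt0 : 0 < D by apply: lt_le_trans D_ge1.
have le_D : D <= x.
  by apply: le_trans le_Dx _; rewrite -[leRHS](powRr1 (ltW x_gt0)) ler_powR //; lra.
have [u [u_gt0 lt_n n_le]] := dyadic_scale q_gt0 D_ge1.
apply: le_trans (total_discrepancy_le omega hL C_ge0 hB D_ge1 le_D u_gt0 lt_n) _.
rewrite lee_fin [leRHS]mulrDl; rewrite -/c1 in n_le.
have half_le : 2 ^- u <= x `^ (- (delta1 / (16 * q%:R))).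
  by apply: powR_half_le q_gt0 x_ge1 le_xD _; move: lt_n; lra.
have N_le := powR_length_le q_gt0 (ltW D_gt0) c1_ge0 n_le.
set n : R := (2 ^ (2 * q * (8 * u)))%:R in lt_n n_le *.
have n_ge0 : 0 <= n by [].
set N : R := (2 ^ ((q + 9) * (8 * u)))%:R in N_le *.
have N_ge1 : 1 <= N by rewrite ler1n expn_gt0.
apply: lerD.
- have D_pow : D * D `^ kappa <= x `^ (1 - eta).
    apply: (@le_trans _ _ (x `^ delta2 * (x `^ delta2) `^ kappa)).
      apply: ler_pM => //; rewrite ?powR_ge0 ?(ltW D_gt0) //.
      rewrite ge0_ler_powR ?nnegrE ?powR_ge0 ?(ltW D_gt0) //.
      by rewrite divr_ge0 // mulr_ge0 // ltW.
    rewrite -powRrM -powRD ?x_neq0 ?implybT // ler_powR //.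
    have eta_le : eta <= e / 2 by rewrite ge_min lexx.
    have -> : kappa = 1 / 2 + 9 / 2 / q%:R.
      by rewrite /kappa natrD; field; rewrite gt_eqF.
    have q_inv : 6 / q%:R <= e.
      by rewrite ler_pdivrMr // mulrC -ler_pdivrMr.
    have h : delta2 * (9 / 2 / q%:R) <= 3 / q%:R.
      have -> : 3 / q%:R = 2 / 3 * (9 / 2 / q%:R) :> R by field; rewrite gt_eqF.
      by rewrite ler_wpM2r ?divr_ge0 // ltW.
    move: eta_le q_inv h; rewrite /e mulrDr.
    have -> : 6 / q%:R = 2 * (3 / q%:R) :> R by ring.
    by set v : R := 3 / q%:R; set w := delta2 * (_ / _); lra.
  apply: (@le_trans _ _ (6 * 2 ^+ L * (D * N))).
    have v_ge1 : 1 <= 2 ^+ L * N by rewrite -[leLHS]mulr1 ler_pM.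
    have -> : 6 * 2 ^+ L * (D * N) = 6 * (D * (2 ^+ L * N)) by ring.
    have := ler_wpM2l (ltW D_gt0) v_ge1; rewrite mulr1.
    by set v := 2 ^+ L * N; lra.
  rewrite -[leRHS]mulrA ler_wpM2l ?mulr_ge0 ?exprn_ge0 //.
  apply: (@le_trans _ _ (D * (c1 `^ kappa * D `^ kappa))).
    by rewrite ler_wpM2l // ltW.
  by rewrite mulrCA ler_wpM2l ?powR_ge0.
have x_pow : x * x `^ (- (delta1 / (16 * q%:R))) <= x `^ (1 - eta).
  rewrite -{1}(powRr1 (ltW x_gt0)) -powRD ?x_neq0 ?implybT // ler_powR //.
  by rewrite lerD2l lerN2 ge_min lexx orbT.
apply: (@le_trans _ _ (2 * 2 ^+ L * c1 * E * (x * 2 ^- u))).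
  have -> : 2 * x / D * (2 ^+ L * (n * 2 ^- u * (1 + 16 * q%:R * C))) =
     2 * 2 ^+ L * (n / D) * E * (x * 2 ^- u) by rewrite /E; ring.
  rewrite ler_wpM2r ?mulr_ge0 ?invr_ge0 ?exprn_ge0 ?(ltW x_gt0) //.
  rewrite ler_wpM2r // ler_wpM2l ?mulr_ge0 ?exprn_ge0 //.
  by rewrite ler_pdivrMr.
rewrite ler_wpM2l ?mulr_ge0 ?exprn_ge0 //.
by apply: le_trans x_pow; rewrite ler_wpM2l // ltW.
Qed.
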